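(* Let $1\le p<\infty$. The sequence $\left(\mathcal{P}^n_{FSt,p},\Pi^n_{FSt,p}\right)_{n=1}^\infty$ is coherent and compatible with $\Pi_p$.
   Context: Scalars $\mathbb{K}=\mathbb{R}$ or $\mathbb{C}$; $E,F,E_j$ denote Banach spaces. $\mathcal{P}(^nE;F)$ is the space of continuous $n$-homogeneous polynomials from $E$ to $F$; $\check P$ is the continuous symmetric $n$-linear map with $\check P(x,\dots,x)=P(x)$. $\Pi_p$ is the ideal of absolutely $p$-summing linear operators: continuous linear $u:E\to F$ for which there is $C\ge0$ with $\left(\sum_{j=1}^N\|u(x_j)\|^p\right)^{1/p}\le C\sup_{\varphi\in B_{E^*}}\left(\sum_{j=1}^N|\varphi(x_j)|^p\right)^{1/p}$ for all $N$ and $x_1,\dots,x_N\in E$; its norm $\pi_p(u)$ is the infimum of such $C$. $\Pi^n_{FSt,p}$ is the ideal of factorable strongly $p$-summing $n$-linear operators: continuous $n$-linear $T:E_1\times\cdots\times E_n\to F$ for which there is $C\ge0$ such that for all positive integers $m_1,m_2$, all $x_{k,j}^i\in E_k$ and all scalars $\lambda_j^i$, $\left(\sum_{j=1}^{m_1}\|\sum_{i=1}^{m_2}\lambda_j^iT(x_{1,j}^i,\dots,x_{n,j}^i)\|^p\right)^{1/p}\le C\sup_{\|\varphi\|\le1}\left(\sum_{j=1}^{m_1}|\sum_{i=1}^{m_2}\lambda_j^i\varphi(x_{1,j}^i,\dots,x_{n,j}^i)|^p\right)^{1/p}$, the supremum over continuous $n$-linear forms of norm at most $1$; the norm $\|T\|_{FSt,p}$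 is the infimum of such $C$. $\mathcal{P}^n_{FSt,p}$ is the ideal of factorable strongly $p$-summing $n$-homogeneous polynomials: $P\in\mathcal{P}(^nE;F)$ for which there is $C\ge0$ such that for all $m_1,m_2$, all $x_j^i\in E$ and all scalars $\lambda_j^i$, $\left(\sum_{j=1}^{m_1}\|\sum_{i=1}^{m_2}\lambda_j^iP(x_j^i)\|^p\right)^{1/p}\le C\sup_{q}\left(\sum_{j=1}^{m_1}|\sum_{i=1}^{m_2}\lambda_j^iq(x_j^i)|^p\right)^{1/p}$, the supremum over continuous $n$-homogeneous scalar polynomials $q$ on $E$ of norm at most $1$; the norm $\|P\|_{FSt,p}$ is the infimum of such $C$. Notation: for $T$ $n$-linear, fixing some variables of $T$ at given vectors gives a multilinear map in the remaining variables; for $P\in\mathcal{P}(^nE;F)$ and $a\in E$, $P_a(x)=\check P(a,x,\dots,x)$ and $P_{a^{n-1}}(x)=\check P(a,\dots,a,x)$. Let $\mathcal{U}$ be a normed operator ideal and $(\mathcal{U}_n,\mathcal{M}_n)_{n=1}^\infty$ a sequence where $\mathcal{U}_n$ is a normed ideal of $n$-homogeneous polynomials, $\mathcal{M}_n$ a normed ideal of $n$-linear operators, and $\mathcal{U}_1=\mathcal{M}_1=\mathcal{U}$. The sequence is compatible with $\mathcal{U}$ if there are positive constants $\alpha_1,\dots,\alpha_4$ such that for all Banach spaces and all $n\ge2$: (CP1) if $T\in\mathcal{M}_n(E_1,\dots,E_n;F)$, $1\le k\le n$ and $a_j\in E_j$ for $j\ne k$, then the linear map $E_k\to F$ obtained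 by fixing the $j$-th variable of $T$ at $a_j$ for all $j\neq k$ is in $\mathcal{U}(E_k;F)$ with norm at most $\alpha_1\|T\|_{\mathcal{M}_n}\prod_{j\ne k}\|a_j\|$; (CP2) if $P\in\mathcal{U}_n(^nE;F)$ and $a\in E$, then $P_{a^{n-1}}\in\mathcal{U}(E;F)$ with norm at most $\alpha_2\max\{\|\check P\|_{\mathcal{M}_n},\|P\|_{\mathcal{U}_n}\}\|a\|^{n-1}$; (CP3) if $u\in\mathcal{U}(E_n;F)$ and $\gamma_j\in E_j^*$ for $1\le j\le n-1$, then $\gamma_1\cdots\gamma_{n-1}u:(x_1,\dots,x_n)\mapsto\gamma_1(x_1)\cdots\gamma_{n-1}(x_{n-1})u(x_n)$ is in $\mathcal{M}_n(E_1,\dots,E_n;F)$ with norm at most $\alpha_3\|\gamma_1\|\cdots\|\gamma_{n-1}\|\|u\|_{\mathcal{U}}$; (CP4) if $u\in\mathcal{U}(E;F)$ and $\gamma\in E^*$, then $\gamma^{n-1}u\in\mathcal{U}_n(^nE;F)$ with norm at most $\alpha_4\|\gamma\|^{n-1}\|u\|_{\mathcal{U}}$; (CP5) $P\in\mathcal{U}_n(^nE;F)$ if and only if $\check P\in\mathcal{M}_n(^nE;F)$. The sequence is coherent if there are positive constants $\beta_1,\dots,\beta_4$ such that for all Banach spaces and all $k\ge1$: (CH1) if $T\in\mathcal{M}_{k+1}(E_1,\dots,E_{k+1};F)$ and $a_j\in E_j$ for some $1\le j\le k+1$, then the $k$-linear map obtained by fixing the $j$-th variable of $T$ at $a_j$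 is in $\mathcal{M}_k$ with norm at most $\beta_1\|T\|_{\mathcal{M}_{k+1}}\|a_j\|$; (CH2) if $P\in\mathcal{U}_{k+1}(^{k+1}E;F)$ and $a\in E$, then $P_a\in\mathcal{U}_k(^kE;F)$ with norm at most $\beta_2\max\{\|\check P\|_{\mathcal{M}_{k+1}},\|P\|_{\mathcal{U}_{k+1}}\}\|a\|$; (CH3) if $T\in\mathcal{M}_k(E_1,\dots,E_k;F)$ and $\gamma\in E_{k+1}^*$, then $\gamma T:(x_1,\dots,x_{k+1})\mapsto\gamma(x_{k+1})T(x_1,\dots,x_k)$ is in $\mathcal{M}_{k+1}(E_1,\dots,E_{k+1};F)$ with norm at most $\beta_3\|\gamma\|\|T\|_{\mathcal{M}_k}$; (CH4) if $P\in\mathcal{U}_k(^kE;F)$ and $\gamma\in E^*$, then $\gamma P\in\mathcal{U}_{k+1}(^{k+1}E;F)$ with norm at most $\beta_4\|\gamma\|\|P\|_{\mathcal{U}_k}$; (CH5) $P\in\mathcal{U}_k(^kE;F)$ if and only if $\check P\in\mathcal{M}_k(^kE;F)$. *)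

(* Defs.v *)
From HB Require Import structures.
From mathcomp Require Import all_boot all_order all_algebra all_fingroup.
From mathcomp Require Import all_classical all_reals all_analysis.
From mathcomp Require Import complex.

Set Implicit Arguments.
Unset Strict Implicit.
Unset Printing Implicit Defensive.

Import Order.TTheory GRing.Theory Num.Theory.
Import numFieldNormedType.Exports.

Local Open Scope classical_set_scope.
Local Open Scope ring_scope.

Lemma complex_complete (R : realType) (F : set_system (R[i])^o) :
  ProperFilter F -> cauchy F -> cvg F.
Proof.
move=> FF /cauchy_ballP Fc.
have normRe (z : R[i]) : `|complex.Re z|%:C%C <= `|z| by exact: normc_ge_Re.
have normIm (z : R[i]) : `|complex.Im z|%:C%C <= `|z|.
  by rewrite normc_def lecR -sqrtr_sqr ler_wsqrtr // lerDr sqr_ge0.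
have part_cvg (f : R[i] -> R) :
    (forall x y, f x - f y = f (x - y)) -> (forall z, `|f z|%:C%C <= `|z|) ->
    cvg ((f : (R[i])^o -> R) @ F).
  move=> fB fle; apply: R_complete; apply/cauchy_ballP => e e0.
  have e0' : 0 < e%:C%C by rewrite ltcR.
  have [[A B] [/= FA FB] AB] := Fc _ e0'.
  exists (f @` A, f @` B) => /=.
    by split; [apply: filterS FA | apply: filterS FB] => x Ax; exists x.
  move=> [_ _] [/= [x Ax <-] [y By <-]].
  have := AB (x, y) (conj Ax By); rewrite /ball /= => xy.
  by rewrite /ball_ /= -ltcR fB; exact: le_lt_trans (fle _) xy.
have /cvg_ex[a Fa] :=
  part_cvg (@complex.Re R) (fun x y => esym (raddfB _ _ _)) normRe.
have /cvg_ex[b Fb] :=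
  part_cvg (@complex.Im R) (fun x y => esym (raddfB _ _ _)) normIm.
apply/cvg_ex; exists (a +i* b)%C.
apply/(@cvgrPdist_lt _ (R[i])^o) => e e0.
have eE : e = (complex.Re e)%:C%C by rewrite RRe_real // gtr0_real.
have e2 : 0 < complex.Re e / 2 by rewrite divr_gt0 // -ltcR -eE.
move/(@cvgrPdist_lt _ R) : Fa => /(_ _ e2) Fa.
move/(@cvgrPdist_lt _ R) : Fb => /(_ _ e2) Fb.
apply: filterS (filterI Fa Fb) => /= -[x y] /= [ax bxy].
rewrite (_ : _ - _ = (a - x)%:C%C + 'i%C * (b - y)%:C%C); last first.
  by rewrite [LHS]complexE.
apply: le_lt_trans (ler_normD _ _) _.
rewrite normrM !normc_def /= expr0n expr1n add0r sqrtr1 mul1r !addr0 !sqrtr_sqr.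
by rewrite -rmorphD /= eE ltcR [ltRHS]splitr ltrD.
Qed.

Variant scalar_kind := RealScalars | ComplexScalars.

Definition scalars (R : realType) (s : scalar_kind) : numFieldType :=
  match s with
  | RealScalars => R : numFieldType
  | ComplexScalars => R[i] : numFieldType
  end.

Lemma scalars_complete (R : realType) (s : scalar_kind)
    (F : set_system (scalars R s)^o) :
  ProperFilter F -> cauchy F -> cvg F.
Proof. by case: s F; [exact: R_complete | exact: complex_complete]. Qed.

Definition scalar_banach (R : realType) (s : scalar_kind) :
    completeNormedModType (scalars R s) :=
  HB.pack ((scalars R s)^o) (Uniform_isComplete.Build _ (@scalars_complete R s)).

Definition scalar_re (R : realType) (s : scalar_kind) : scalars R s -> R :=
  match s return scalars R s -> R with
  | RealScalars => fun x => x
  | ComplexScalars => fun z : R[i] => complex.Re z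
  end.

(* The norm of a normedModType over K takes its values in K, and is a
   nonnegative real element of it; rnorm is the same number seen in R. *)
Definition rnorm (R : realType) (s : scalar_kind)
    (V : normedModType (scalars R s)) (x : V) : R :=
  scalar_re `|x|.

(* The family over 'I_k.+1 with value a at j, the remaining variables being
   filled with x. *)
Definition insert_at k (E : 'I_k.+1 -> Type) (j : 'I_k.+1) (a : E j)
    (x : forall i : 'I_k, E (lift j i)) (i : 'I_k.+1) : E i :=
  match unliftP j i with
  | UnliftSome i' e => ecast z (E z) (esym e) (x i')
  | UnliftNone e => ecast z (E z) (esym e) a
  end.

Lemma insert_at_same k (E : 'I_k.+1 -> Type) j (a : E j)
    (x : forall i, E (lift j i)) :
  insert_at a x j = a.
Proof.
rewrite /insert_at; case: unliftP => [i e|e]; last by rewrite eq_axiomK.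
by exfalso; have := neq_lift j i; rewrite -e eqxx.
Qed.

Lemma insert_at_lift k (E : 'I_k.+1 -> Type) j (a : E j)
    (x : forall i, E (lift j i)) (i : 'I_k) :
  insert_at a x (lift j i) = x i.
Proof.
rewrite /insert_at; case: unliftP => [i' e|e].
  by have ii := lift_inj e; subst i'; rewrite eq_axiomK.
by exfalso; have := neq_lift j i; rewrite e eqxx.
Qed.

Section MappingIdeals.
Context (R : realType) (s : scalar_kind).
Notation K := (scalars R s).
Notation banach := (completeNormedModType K).

Section Mappings.

Definition cont_linear (E F : normedModType K) (u : E -> F) : Prop :=
  linear u /\ continuous u.

Definition multilinear n (E : 'I_n -> banach) (F : normedModType K)
    (T : (forall i, E i) -> F) : Prop :=
  forall (x : forall i, E i) (i : 'I_n) (a : K) (y z : E i),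
    T (dfwith x i (a *: y + z)) = a *: T (dfwith x i y) + T (dfwith x i z).

Definition cont_multilinear n (E : 'I_n -> banach) (F : normedModType K)
    (T : (forall i, E i) -> F) : Prop :=
  multilinear T /\ continuous (T : prod_topology E -> F).

Definition cont_poly n (E : banach) (F : normedModType K) (P : E -> F)
    : Prop :=
  (exists2 A : ('I_n -> E) -> F,
     multilinear (E := fun=> E) A & forall x, P x = A (fun=> x)) /\
  continuous P.

Definition symmetric_map n (E F : Type) (A : ('I_n -> E) -> F) : Prop :=
  forall (t : 'S_n) (x : 'I_n -> E), A (x \o t) = A x.

(* The map written P with a check accent on paper; the default value of xget is
   only reached when P is not a continuous n-homogeneous polynomial. *)
Definition polar n (E : banach) (F : normedModType K) (P : E -> F) :
    ('I_n -> E) -> F :=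
  xget (fun=> 0) [set A | [/\ cont_multilinear (E := fun=> E) A,
                              symmetric_map A & forall x, A (fun=> x) = P x]].

Definition map_norm (E F : normedModType K) (P : E -> F) : R :=
  sup [set rnorm (P x) | x in [set x : E | rnorm x <= 1]].

Definition ml_norm n (E : 'I_n -> banach) (F : normedModType K)
    (T : (forall i, E i) -> F) : R :=
  sup [set rnorm (T x) | x in
        [set x : forall i, E i | forall i, rnorm (x i) <= 1]].

End Mappings.

#[global] Arguments polar n {E F} P.

(* A class of maps between Banach spaces together with a candidate norm, which
   is only meaningful on the members of the class. *)
Record map_class := MapClass {
  map_mem : forall E F : banach, set (E -> F);
  map_size : forall E F : banach, (E -> F) -> R }.

Record ml_class n := MlClass {
  ml_mem : forall (E : 'I_n -> banach) (F : banach),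
    set ((forall i, E i) -> F);
  ml_size : forall (E : 'I_n -> banach) (F : banach),
    ((forall i, E i) -> F) -> R }.

Record normed_subspace (V : lmodType K) (D : set V) (N : V -> R) : Prop := {
  nsub0 : D 0;
  nsubP : forall (a : K) (u v : V), D u -> D v -> D (a *: u + v);
  nsub_ge0 : forall u, D u -> 0 <= N u;
  nsub_eq0 : forall u, D u -> N u = 0 -> u = 0;
  nsubZ : forall (a : K) u, D u -> N (a *: u) = rnorm (a : K^o) * N u;
  nsubD : forall u v, D u -> D v -> N (u + v) <= N u + N v }.

(* Normed ideals of continuous n-homogeneous polynomials, and for n = 1 of
   continuous linear operators; adm is the class of all such maps.  Since the
   components are linear subspaces, containing the maps gamma^n b amounts to
   containing all the maps of finite type. *)
Record normed_map_ideal n (adm : forall E F : banach, set (E -> F))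
    (U : map_class) : Prop := {
  mi_sub : forall E F : banach, map_mem U (E := E) (F := F) `<=` @adm E F;
  mi_norm : forall E F : banach,
    normed_subspace (map_mem U (E := E) (F := F))
                    (map_size U (E := E) (F := F));
  mi_finite : forall (E F : banach) (g : E -> K^o) (b : F),
    cont_linear g -> map_mem U (fun x => g x ^+ n *: b);
  mi_comp : forall (E F G H : banach) (u : G -> E) (P : E -> F) (v : F -> H),
    cont_linear u -> map_mem U P -> cont_linear v ->
    map_mem U (v \o P \o u) /\
    map_size U (v \o P \o u) <= map_norm v * map_size U P * map_norm u ^+ n;
  mi_one : map_size U (E := scalar_banach R s) (F := scalar_banach R s)
             (fun x => (x : K^o) ^+ n) = 1 }.

Definition normed_operator_ideal (U : map_class) : Prop :=
  normed_map_ideal 1 (fun E F => @cont_linear E F) U.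

Definition normed_poly_ideal n (U : map_class) : Prop :=
  normed_map_ideal n (fun E F => @cont_poly n E F) U.

Record normed_multi_ideal n (M : ml_class n) : Prop := {
  mli_sub : forall (E : 'I_n -> banach) (F : banach),
    ml_mem M (E := E) (F := F) `<=` @cont_multilinear n E F;
  mli_norm : forall (E : 'I_n -> banach) (F : banach),
    normed_subspace (ml_mem M (E := E) (F := F))
                    (ml_size M (E := E) (F := F));
  mli_finite : forall (E : 'I_n -> banach) (F : banach)
      (g : forall i, E i -> K^o) (b : F),
    (forall i, cont_linear (g i)) ->
    ml_mem M (fun x : forall i, E i => (\prod_(i < n) g i (x i)) *: b);
  mli_comp : forall (E G : 'I_n -> banach) (F H : banach)
      (u : forall i, G i -> E i) (T : (forall i, E i) -> F) (v : F -> H),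
    (forall i, cont_linear (u i)) -> ml_mem M T -> cont_linear v ->
    let vTu := fun x : forall i, G i => v (T (fun i => u i (x i))) in
    ml_mem M vTu /\
    ml_size M vTu <=
      map_norm v * ml_size M T * \prod_(i < n) map_norm (u i);
  mli_one : ml_size M (E := fun=> scalar_banach R s) (F := scalar_banach R s)
              (fun x => \prod_(i < n) (x i : K^o)) = 1 }.

(* The standing assumptions under which compatibility and coherence are
   defined.  The equality U_1 = M_1 = U is isometric, operators being identified
   with 1-homogeneous polynomials and with 1-linear maps. *)
Record ideal_sequence (U : map_class) (Un : nat -> map_class)
    (Mn : forall n, ml_class n) : Prop := {
  iseq_op : normed_operator_ideal U;
  iseq_poly : forall n, (1 <= n)%N -> normed_poly_ideal n (Un n);
  iseq_multi : forall n, (1 <= n)%N -> normed_multi_ideal (Mn n);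
  iseq_poly1 : forall (E F : banach) (u : E -> F),
    (map_mem (Un 1) u <-> map_mem U u) /\
    (map_mem U u -> map_size (Un 1) u = map_size U u);
  iseq_multi1 : forall (E : 'I_1 -> banach) (F : banach) (u : E ord0 -> F),
    let u1 := fun x : forall i, E i => u (x ord0) in
    (ml_mem (Mn 1) u1 <-> map_mem U u) /\
    (map_mem U u -> ml_size (Mn 1) u1 = map_size U u) }.

Section Conditions.
Variables (U : map_class) (Un : nat -> map_class) (Mn : forall n, ml_class n).

(* The value of a at k plays no role. *)
Definition CP1 (c : R) : Prop :=
  forall n, (2 <= n)%N ->
  forall (E : 'I_n -> banach) (F : banach) (T : (forall i, E i) -> F)
    (k : 'I_n) (a : forall i, E i),
  ml_mem (Mn n) T ->
  let Tk := fun x : E k => T (dfwith a k x) in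
  map_mem U Tk /\
  map_size U Tk <= c * ml_size (Mn n) T * \prod_(j < n | j != k) rnorm (a j).

Definition CP2 (c : R) : Prop :=
  forall n, (1 <= n)%N ->
  forall (E F : banach) (P : E -> F) (a : E),
  map_mem (Un n.+1) P ->
  let Pa := fun x : E =>
    polar n.+1 P (fun i => if i == ord_max then x else a) in
  map_mem U Pa /\
  map_size U Pa <=
    c * Num.max (ml_size (Mn n.+1) (E := fun=> E) (polar n.+1 P))
                (map_size (Un n.+1) P) * rnorm a ^+ n.

Definition CP3 (c : R) : Prop :=
  forall n, (1 <= n)%N ->
  forall (E : 'I_n.+1 -> banach) (F : banach) (u : E ord_max -> F)
    (g : forall i : 'I_n, E (lift ord_max i) -> K^o),
  map_mem U u -> (forall i, cont_linear (g i)) ->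
  let gu := fun x : forall i, E i =>
    (\prod_(i < n) g i (x (lift ord_max i))) *: u (x ord_max) in
  ml_mem (Mn n.+1) gu /\
  ml_size (Mn n.+1) gu <= c * (\prod_(i < n) map_norm (g i)) * map_size U u.

Definition CP4 (c : R) : Prop :=
  forall n, (1 <= n)%N ->
  forall (E F : banach) (u : E -> F) (g : E -> K^o),
  map_mem U u -> cont_linear g ->
  let gu := fun x : E => g x ^+ n *: u x in
  map_mem (Un n.+1) gu /\
  map_size (Un n.+1) gu <= c * map_norm g ^+ n * map_size U u.

Definition CP5 : Prop :=
  forall n, (2 <= n)%N ->
  forall (E F : banach) (P : E -> F), cont_poly n P ->
  map_mem (Un n) P <-> ml_mem (Mn n) (E := fun=> E) (polar n P).

Definition compatible : Prop :=
  ideal_sequence U Un Mn /\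
  exists a1 a2 a3 a4 : R,
    [/\ 0 < a1, 0 < a2, 0 < a3 & 0 < a4] /\
    [/\ CP1 a1, CP2 a2, CP3 a3, CP4 a4 & CP5].

Definition CH1 (c : R) : Prop :=
  forall k, (1 <= k)%N ->
  forall (E : 'I_k.+1 -> banach) (F : banach) (T : (forall i, E i) -> F)
    (j : 'I_k.+1) (a : E j),
  ml_mem (Mn k.+1) T ->
  let Ta := fun x : forall i : 'I_k, E (lift j i) => T (insert_at a x) in
  ml_mem (Mn k) (E := fun i => E (lift j i)) Ta /\
  ml_size (Mn k) (E := fun i => E (lift j i)) Ta <=
    c * ml_size (Mn k.+1) T * rnorm a.

Definition CH2 (c : R) : Prop :=
  forall k, (1 <= k)%N ->
  forall (E F : banach) (P : E -> F) (a : E),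
  map_mem (Un k.+1) P ->
  let Pa := fun x : E =>
    polar k.+1 P (fun i => if i == ord0 then a else x) in
  map_mem (Un k) Pa /\
  map_size (Un k) Pa <=
    c * Num.max (ml_size (Mn k.+1) (E := fun=> E) (polar k.+1 P))
                (map_size (Un k.+1) P) * rnorm a.

Definition CH3 (c : R) : Prop :=
  forall k, (1 <= k)%N ->
  forall (E : 'I_k.+1 -> banach) (F : banach)
    (T : (forall i : 'I_k, E (lift ord_max i)) -> F) (g : E ord_max -> K^o),
  ml_mem (Mn k) (E := fun i => E (lift ord_max i)) T -> cont_linear g ->
  let gT := fun x : forall i, E i =>
    g (x ord_max) *: T (fun i => x (lift ord_max i)) in
  ml_mem (Mn k.+1) gT /\
  ml_size (Mn k.+1) gT <=
    c * map_norm g * ml_size (Mn k) (E := fun i => E (lift ord_max i)) T.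

Definition CH4 (c : R) : Prop :=
  forall k, (1 <= k)%N ->
  forall (E F : banach) (P : E -> F) (g : E -> K^o),
  map_mem (Un k) P -> cont_linear g ->
  let gP := fun x : E => g x *: P x in
  map_mem (Un k.+1) gP /\
  map_size (Un k.+1) gP <= c * map_norm g * map_size (Un k) P.

Definition CH5 : Prop :=
  forall k, (1 <= k)%N ->
  forall (E F : banach) (P : E -> F), cont_poly k P ->
  map_mem (Un k) P <-> ml_mem (Mn k) (E := fun=> E) (polar k P).

Definition coherent : Prop :=
  ideal_sequence U Un Mn /\
  exists b1 b2 b3 b4 : R,
    [/\ 0 < b1, 0 < b2, 0 < b3 & 0 < b4] /\
    [/\ CH1 b1, CH2 b2, CH3 b3, CH4 b4 & CH5].

End Conditions.

Section SummingIdeals.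
Variable p : R.

Definition lp_norm m (r : 'I_m -> R) : R := (\sum_(j < m) r j `^ p) `^ p^-1.

(* All the suprema below are over nonempty bounded sets of reals. *)
Definition summing_bound (E F : banach) (u : E -> F) (C : R) : Prop :=
  forall (N : nat) (x : 'I_N -> E),
  lp_norm (fun j => rnorm (u (x j))) <=
  C * sup [set lp_norm (fun j => rnorm (phi (x j))) | phi in
            [set phi : E -> K^o | cont_linear phi /\ map_norm phi <= 1]].

Definition summing : map_class := {|
  map_mem := fun E F : banach => [set u : E -> F |
    cont_linear u /\ exists2 C, 0 <= C & summing_bound u C];
  map_size := fun (E F : banach) (u : E -> F) =>
    inf [set C | 0 <= C /\ summing_bound u C] |}.

Definition FSt_multi_bound n (E : 'I_n -> banach) (F : banach)
    (T : (forall i, E i) -> F) (C : R) : Prop :=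
  forall m1 m2 : nat, (0 < m1)%N -> (0 < m2)%N ->
  forall (x : 'I_m1 -> 'I_m2 -> forall k, E k) (l : 'I_m1 -> 'I_m2 -> K),
  lp_norm (fun j => rnorm (\sum_(i < m2) l j i *: T (x j i))) <=
  C * sup [set lp_norm (fun j =>
                  rnorm (\sum_(i < m2) l j i *: phi (x j i))) | phi in
            [set phi : (forall k, E k) -> K^o |
              cont_multilinear phi /\ ml_norm phi <= 1]].

Definition FSt_multi n : ml_class n := {|
  ml_mem := fun (E : 'I_n -> banach) (F : banach) =>
    [set T : (forall i, E i) -> F |
      cont_multilinear T /\ exists2 C, 0 <= C & FSt_multi_bound T C];
  ml_size := fun (E : 'I_n -> banach) (F : banach)
      (T : (forall i, E i) -> F) =>
    inf [set C | 0 <= C /\ FSt_multi_bound T C] |}.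

Definition FSt_poly_bound n (E F : banach) (P : E -> F) (C : R) : Prop :=
  forall m1 m2 : nat, (0 < m1)%N -> (0 < m2)%N ->
  forall (x : 'I_m1 -> 'I_m2 -> E) (l : 'I_m1 -> 'I_m2 -> K),
  lp_norm (fun j => rnorm (\sum_(i < m2) l j i *: P (x j i))) <=
  C * sup [set lp_norm (fun j =>
                  rnorm (\sum_(i < m2) l j i *: q (x j i))) | q in
            [set q : E -> K^o | cont_poly n q /\ map_norm q <= 1]].

Definition FSt_poly n : map_class := {|
  map_mem := fun E F : banach => [set P : E -> F |
    cont_poly n P /\ exists2 C, 0 <= C & FSt_poly_bound n P C];
  map_size := fun (E F : banach) (P : E -> F) =>
    inf [set C | 0 <= C /\ FSt_poly_bound n P C] |}.

End SummingIdeals.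

End MappingIdeals.

(* Main.v *)
Require Import Defs.
From HB Require Import structures.
From mathcomp Require Import all_boot all_order all_algebra all_fingroup.
From mathcomp Require Import all_classical all_reals all_analysis.
From mathcomp Require Import complex ring.

(** All the conditions of coherence and compatibility hold with constant 1, and
   they come down to one observation. Call a map T on a set X dominated by a
   class of scalar forms on X when the p-norms of finite families of linear
   combinations of its values are at most a constant times the supremum of the
   p-norms of the same combinations of the forms of norm at most 1
   (dom_bound). Factorable strongly p-summing multilinear operators and
   polynomials are the maps dominated by the continuous multilinear forms and by
   the continuous homogeneous polynomials. A p-summing operator u is a linear map
   dominated by the continuous linear forms: by linearity, a combination of
   values of u is a value of u, so that allowing linear combinations in the
   inequality changes nothing (summing_boundE).

   Since the inequality tolerates arbitrary linear combinations, it passes from T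
   to every map S whose values are combinations of values of T, provided that the
   same combinations of the values of a form of the first class give a form of
   the second one, with control of the norm (dominated_transfer). Fixing some
   variables, multiplying by a linear form (the values of which are absorbed in
   the coefficients of the combinations), composing with bounded linear maps and
   restricting to the diagonal are all instances with combinations of a single
   term. That P is dominated if and only if its polar form is uses combinations of
   several terms: the polarization formula writes the polar form of P at a point as
   a combination of 2 ^ n values of P, with the same coefficients for every
   polynomial; applied to scalar polynomials of norm at most 1, it also bounds
   the norms of their polar forms by a constant depending on n only
   (polar_norm_le). As this equivalence asks for membership only, that constant is
   harmless: in the conditions on polynomials with fixed variables, the norm of
   the polar form is one of the two terms of the maximum.

   The remaining axioms of a sequence of normed ideals follow from Minkowski's
   inequality (lp_normD), from the fact that the infimum defining the norm of a
   dominated map is attained (dom_sizeP) and, again, from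
   dominated_transfer. *)

Set Implicit Arguments.
Unset Strict Implicit.
Unset Printing Implicit Defensive.

Import Order.TTheory GRing.Theory Num.Theory.
Import numFieldNormedType.Exports.

Local Open Scope classical_set_scope.
Local Open Scope ring_scope.

(** * Real parts of scalars and real-valued norms *)

Section RealScalarPart.
Context (R : realType) (s : scalar_kind).
Notation K := (scalars R s).

(** The embedding of the reals into the scalars. *)
Definition of_real : R -> K :=
  match s return R -> scalars R s with
  | RealScalars => fun r => r
  | ComplexScalars => fun r => (r%:C)%C
  end.

Lemma of_realK (r : R) : scalar_re (of_real r) = r.
Proof. by rewrite /of_real /scalar_re; case: s. Qed.

Lemma scalar_reK (x : K) : 0 <= x -> of_real (scalar_re x) = x.
Proof.
rewrite /of_real /scalar_re; case: s x => //= x x0.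
by rewrite RRe_real // ger0_real.
Qed.

Lemma ler_scalar_re (x y : K) : x <= y -> scalar_re x <= scalar_re y.
Proof.
by rewrite /scalar_re; case: s x y => //= -[a b] [c d]; rewrite lecE => /andP[].
Qed.

Lemma scalar_re_gt0 (x : K) : 0 < x -> 0 < scalar_re x.
Proof.
by rewrite /scalar_re; case: s x => //= -[a b]; rewrite ltcE => /andP[].
Qed.

Lemma scalar_reD (x y : K) : scalar_re (x + y) = scalar_re x + scalar_re y.
Proof. by rewrite /scalar_re; case: s x y => //= -[a b] [c d]. Qed.

Lemma scalar_re0 : scalar_re (0 : K) = 0.
Proof. by rewrite /scalar_re; case: s. Qed.

Lemma scalar_re1 : scalar_re (1 : K) = 1.
Proof. by rewrite /scalar_re; case: s. Qed.

Lemma of_realM (x y : R) : of_real (x * y) = of_real x * of_real y.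
Proof. by rewrite /of_real; case: s => //; exact: rmorphM. Qed.

Lemma of_real_ge0 (x : R) : (0 <= of_real x) = (0 <= x).
Proof. by rewrite /of_real; case: s => //; rewrite lecR. Qed.

Lemma of_real_lt (x y : R) : (of_real x < of_real y) = (x < y).
Proof. by rewrite /of_real; case: s => //; rewrite ltcR. Qed.

Lemma scalar_reM (x y : K) : 0 <= x -> 0 <= y ->
  scalar_re (x * y) = scalar_re x * scalar_re y.
Proof.
move=> x0 y0; rewrite -{1}(scalar_reK x0) -{1}(scalar_reK y0).
by rewrite -of_realM of_realK.
Qed.

Section Normed.
Variable V : normedModType K.
Implicit Types x y : V.

Lemma rnorm_ge0 x : 0 <= rnorm x.
Proof. by rewrite -scalar_re0 /rnorm; apply: ler_scalar_re. Qed.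

Lemma of_real_rnorm x : of_real (rnorm x) = `|x|.
Proof. by rewrite scalar_reK. Qed.

Lemma norm_lt_rnorm x (e : K) : 0 < e -> (`|x| < e) = (rnorm x < scalar_re e).
Proof.
by move=> e0; rewrite -of_real_rnorm -{1}(scalar_reK (ltW e0)) of_real_lt.
Qed.

Lemma rnormD x y : rnorm (x + y) <= rnorm x + rnorm y.
Proof. by rewrite /rnorm -scalar_reD; apply/ler_scalar_re/ler_normD. Qed.

Lemma rnormZ (a : K) x : rnorm (a *: x) = rnorm (a : K^o) * rnorm x.
Proof. by rewrite /rnorm normrZ scalar_reM. Qed.

Lemma rnorm0 : rnorm (0 : V) = 0.
Proof. by rewrite /rnorm normr0 scalar_re0. Qed.

Lemma rnormN x : rnorm (- x) = rnorm x.
Proof. by rewrite /rnorm normrN. Qed.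

Lemma rnorm0_eq0 x : rnorm x = 0 -> x = 0.
Proof.
move=> x0; apply/normr0_eq0; rewrite -of_real_rnorm x0 -scalar_re0.
by rewrite scalar_reK.
Qed.

Lemma rnorm_gt0 x : x != 0 -> 0 < rnorm x.
Proof.
by move=> x0; rewrite lt_neqAle rnorm_ge0 andbT eq_sym; apply: contraNN x0 =>
   /eqP /rnorm0_eq0 ->.
Qed.

Lemma rnorm_normalize x : x != 0 -> rnorm (`|x|^-1 *: x) = 1.
Proof.
by move=> x0; rewrite /rnorm normrZ normfV normr_id mulVf ?normr_eq0 // scalar_re1.
Qed.

Lemma rnorm_sum (I : Type) (r : seq I) (f : I -> V) :
  rnorm (\sum_(i <- r) f i) <= \sum_(i <- r) rnorm (f i).
Proof.
elim/big_ind2 : _ => [|x a y b xa yb|i _]; rewrite ?rnorm0 //.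
by rewrite (le_trans (rnormD _ _)) // lerD.
Qed.

End Normed.

Lemma rnormM (a b : K) : rnorm (a * b : K^o) = rnorm (a : K^o) * rnorm (b : K^o).
Proof. exact: (@rnormZ K^o). Qed.

Lemma rnorm1 : rnorm (1 : K^o) = 1.
Proof. by rewrite /rnorm normr1 scalar_re1. Qed.

Lemma rnorm_prod (I : Type) (r : seq I) (P : pred I) (f : I -> K) :
  rnorm (\prod_(i <- r | P i) f i : K^o) = \prod_(i <- r | P i) rnorm (f i : K^o).
Proof. by rewrite (big_morph (fun a : K => rnorm (a : K^o)) rnormM rnorm1). Qed.

Lemma rnormX n (a : K) : rnorm (a ^+ n : K^o) = rnorm (a : K^o) ^+ n.
Proof. by elim: n => [|n IH]; rewrite ?rnorm1 // !exprS rnormM IH. Qed.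

Lemma rnorm_norm (V : normedModType K) (x : V) : rnorm (`|x| : K^o) = rnorm x.
Proof. by rewrite /rnorm normr_id. Qed.

Lemma rnorm_of_real (c : R) : 0 <= c -> rnorm (of_real c : K^o) = c.
Proof. by move=> c0; rewrite /rnorm ger0_norm ?of_real_ge0 // of_realK. Qed.

Lemma of_real_eq0 (c : R) : of_real c = 0 -> c = 0.
Proof. by move=> /(congr1 (@scalar_re R s)); rewrite of_realK scalar_re0. Qed.

End RealScalarPart.

#[global] Arguments of_real {R} s.

(** * The finite-dimensional p-norm *)

Section LpNorm.
Context (R : realType) (p : R) (hp : 1 <= p).

Let p_gt0 : 0 < p. Proof. exact: lt_le_trans hp. Qed.
Let p_ge0 : 0 <= p. Proof. exact: ltW. Qed.
Let p_neq0 : p != 0. Proof. by rewrite gt_eqF. Qed.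

Lemma lp_norm_ge0 m (f : 'I_m -> R) : 0 <= lp_norm p f.
Proof. exact: powR_ge0. Qed.

Lemma lp_sum_ge0 m (f : 'I_m -> R) : 0 <= \sum_(j < m) f j `^ p.
Proof. by apply: sumr_ge0 => j _; exact: powR_ge0. Qed.

Lemma lp_norm_pow m (f : 'I_m -> R) : lp_norm p f `^ p = \sum_(j < m) f j `^ p.
Proof. by rewrite /lp_norm -powRrM mulVf // powRr1 // lp_sum_ge0. Qed.

Lemma lp_norm_le m (f g : 'I_m -> R) : (forall j, 0 <= f j <= g j) ->
  lp_norm p f <= lp_norm p g.
Proof.
move=> fg; rewrite /lp_norm ge0_ler_powR ?nnegrE ?invr_ge0 ?lp_sum_ge0 //.
apply: ler_sum => j _; have /andP[f0 fgj] := fg j.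
by rewrite ge0_ler_powR ?nnegrE // (le_trans f0).
Qed.

Lemma lp_normZ m (c : R) (f : 'I_m -> R) : 0 <= c -> (forall j, 0 <= f j) ->
  lp_norm p (fun j => c * f j) = c * lp_norm p f.
Proof.
move=> c0 f0; rewrite /lp_norm.
under eq_bigr do rewrite powRM //.
rewrite -mulr_sumr powRM ?powR_ge0 ?lp_sum_ge0 //.
by rewrite -powRrM mulfV // powRr1.
Qed.

Lemma lp_norm1 (f : 'I_1 -> R) : 0 <= f ord0 -> lp_norm p f = f ord0.
Proof. by move=> f0; rewrite /lp_norm big_ord1 -powRrM mulfV // powRr1. Qed.

Lemma lp_norm_empty (f : 'I_0 -> R) : lp_norm p f = 0.
Proof. by rewrite /lp_norm big_ord0 powR0 // invr_neq0. Qed.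

Lemma lp_norm_eq0 m (f : 'I_m -> R) : lp_norm p f = 0 -> forall j, f j = 0.
Proof.
move=> f0 j; have /eqP : \sum_(j < m) f j `^ p = 0.
  by rewrite -lp_norm_pow f0 powR0.
rewrite psumr_eq0 => [|i _]; last exact: powR_ge0.
by move=> /allP/(_ j (mem_index_enum j)) /eqP/powR_eq0_eq0.
Qed.

(** Convexity of the p-th power, at the points x / a and y / b and with the
   weights a / (a + b) and b / (a + b). *)
Lemma powR_convex_div (a b x y : R) : 0 < a -> 0 < b -> 0 <= x -> 0 <= y ->
  ((x + y) / (a + b)) `^ p <=
  a / (a + b) * (x `^ p / a `^ p) + b / (a + b) * (y `^ p / b `^ p).
Proof.
move=> a_gt0 b_gt0 x0 y0; have ab_gt0 : 0 < a + b by rewrite addr_gt0.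
have [a_neq0 b_neq0 ab_neq0] : [/\ a != 0, b != 0 & a + b != 0].
  by rewrite !gt_eqF.
have [aV0 bV0] : 0 <= a^-1 /\ 0 <= b^-1 by rewrite !invr_ge0 !ltW.
have t0 : 0 <= a / (a + b) by rewrite divr_ge0 // ltW.
have t1 : a / (a + b) <= 1 by rewrite ler_pdivrMr // mul1r lerDl ltW.
have onem_t : 1 - a / (a + b) = b / (a + b) by field.
have in0 (z : R) : 0 <= z -> z \in (`[0, +oo[%classic : set R).
  by move=> z0; rewrite inE /= in_itv /= z0.
have := convex_powR hp (Itv01 t0 t1) (in0 _ (mulr_ge0 x0 aV0))
  (in0 _ (mulr_ge0 y0 bV0)).
rewrite [X in X `^ _ <= _ -> _]convRE convRE /= /unstable.onem onem_t.
have -> : a / (a + b) * (x / a) + b / (a + b) * (y / b) =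
    (x + y) / (a + b) by field; rewrite ab_neq0 b_neq0 a_neq0.
have invp c : 0 < c -> c^-1 `^ p = (c `^ p)^-1.
  by move=> c0; rewrite -(powR_inv1 (ltW c0)) -powRrM mulN1r powRN.
have abV0 : 0 <= (a + b)^-1 by rewrite invr_ge0 ltW.
by rewrite !powRM ?addr_ge0 // !invp.
Qed.

(** Minkowski's inequality for finite sums. *)
Lemma lp_normD m (f g : 'I_m -> R) :
  (forall j, 0 <= f j) -> (forall j, 0 <= g j) ->
  lp_norm p (fun j => f j + g j) <= lp_norm p f + lp_norm p g.
Proof.
move=> f0 g0; move aE : (lp_norm p f) => a; move bE : (lp_norm p g) => b.
have [a_eq0|a_neq0] := eqVneq a 0.
  rewrite a_eq0 add0r -bE; apply: lp_norm_le => j.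
  by rewrite (lp_norm_eq0 (etrans aE a_eq0)) add0r g0 lexx.
have [b_eq0|b_neq0] := eqVneq b 0.
  rewrite b_eq0 addr0 -aE; apply: lp_norm_le => j.
  by rewrite (lp_norm_eq0 (etrans bE b_eq0)) addr0 f0 lexx.
have a_gt0 : 0 < a by rewrite lt_neqAle eq_sym a_neq0 -aE lp_norm_ge0.
have b_gt0 : 0 < b by rewrite lt_neqAle eq_sym b_neq0 -bE lp_norm_ge0.
have ab_gt0 : 0 < a + b by rewrite addr_gt0.
have ab_neq0 : a + b != 0 by rewrite gt_eqF.
have conv j := powR_convex_div a_gt0 b_gt0 (f0 j) (g0 j).
have le1 : \sum_(j < m) ((f j + g j) / (a + b)) `^ p <= 1.
  apply: le_trans (ler_sum _ (fun j _ => conv j)) _.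
  rewrite big_split /= -!mulr_sumr -!mulr_suml -!lp_norm_pow aE bE.
  rewrite !mulfV ?powR_eq0 ?(negbTE a_neq0) ?(negbTE b_neq0) // !mulr1.
  by rewrite -mulrDl mulfV.
have -> : lp_norm p (fun j => f j + g j) =
    (a + b) * lp_norm p (fun j => (f j + g j) / (a + b)).
  have fg0 j : 0 <= (f j + g j) / (a + b).
    by rewrite divr_ge0 ?addr_ge0 // ltW.
  rewrite -(lp_normZ (ltW ab_gt0) fg0).
  by congr lp_norm; apply/funext => j; rewrite mulrC divfK.
rewrite -[leRHS]mulr1 ler_pM2l // /lp_norm.
have -> : 1 = 1 `^ p^-1 :> R by rewrite powR1.
by rewrite ge0_ler_powR ?nnegrE ?invr_ge0 ?lp_sum_ge0.
Qed.

End LpNorm.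

(** * Continuity in products *)

Section ProductTopology.
Context (I : choiceType) (E : I -> topologicalType).

Lemma cvg_prod_topology (F : set_system (prod_topology E)) (t : prod_topology E) :
  Filter F -> (forall i, (fun x : prod_topology E => x i) @ F --> t i) ->
  F --> t.
Proof.
move=> FF cvgF; apply/cvg_sup => i U [V [[W oW <-] Wt WU]].
by apply: filterS WU _; apply: cvgF; exact: open_nbhs_nbhs.
Qed.

Lemma continuous_coord i : continuous (fun x : prod_topology E => x i).
Proof. exact: proj_continuous. Qed.

Lemma continuous_prod_topology (X : topologicalType) (f : X -> prod_topology E) :
  (forall i, continuous (fun x => f x i)) -> continuous f.
Proof. by move=> cf x; apply: cvg_prod_topology => i; exact: cf. Qed.

End ProductTopology.

(** * Bounds on continuous multilinear maps *)

Section Multilinear.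
Context (R : realType) (s : scalar_kind).
Notation K := (scalars R s).
Notation banach := (completeNormedModType K).

Section Fixed.
Context (n : nat) (E : 'I_n -> banach) (F : normedModType K).
Implicit Types (T : (forall i, E i) -> F) (x : forall i, E i).

Lemma multilinear_coordD T x i y z : multilinear T ->
  T (dfwith x i (y + z)) = T (dfwith x i y) + T (dfwith x i z).
Proof. by move=> /(_ x i 1 y z); rewrite !scale1r. Qed.

Lemma multilinear_coord0 T x i : multilinear T -> T (dfwith x i 0) = 0.
Proof.
by move=> /(_ x i (-1) 0 0); rewrite scaler0 addr0 scaleN1r addNr.
Qed.

Lemma multilinear_coordZ T x i a y : multilinear T ->
  T (dfwith x i (a *: y)) = a *: T (dfwith x i y).
Proof.
by move=> mT; rewrite -[a *: y]addr0 mT multilinear_coord0 // addr0.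
Qed.

Lemma multilinear_coord_sum T x i (J : Type) (r : seq J) (P : pred J)
    (f : J -> E i) : multilinear T ->
  T (dfwith x i (\sum_(j <- r | P j) f j)) =
  \sum_(j <- r | P j) T (dfwith x i (f j)).
Proof.
move=> mT; apply: (big_morph (fun y => T (dfwith x i y))).
  by move=> y z; exact: multilinear_coordD.
exact: multilinear_coord0.
Qed.

Lemma dfwith_id x i : dfwith x i (x i) = x.
Proof. by apply: functional_extensionality_dep => j; case: dfwithP. Qed.

Lemma multilinear_eq0 T x i : multilinear T -> x i = 0 -> T x = 0.
Proof. by move=> mT xi0; rewrite -(dfwith_id x i) xi0 multilinear_coord0. Qed.

Lemma multilinearZ T (a : 'I_n -> K) x : multilinear T ->
  T (fun i => a i *: x i) = (\prod_(i < n) a i) *: T x.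
Proof.
move=> mT.
(* the coordinates in r are rescaled, one at a time *)
pose xr (r : seq 'I_n) i := if i \in r then a i *: x i else x i.
have step (r : seq 'I_n) : uniq r -> T (xr r) = (\prod_(i <- r) a i) *: T x.
  elim: r => [_|k r IH /= /andP[kr ur]].
    by rewrite big_nil scale1r; congr T; apply: functional_extensionality_dep.
  have -> : xr (k :: r) = dfwith (xr r) k (a k *: x k).
    apply: functional_extensionality_dep => j; case: dfwithP => [|j' kj'].
      by rewrite /xr mem_head.
    by rewrite /xr in_cons eq_sym (negbTE kj').
  have -> : x k = xr r k by rewrite /xr (negbTE kr).
  by rewrite multilinear_coordZ // dfwith_id IH // scalerA big_cons.
rewrite -step ?index_enum_uniq //; congr T.
by apply: functional_extensionality_dep => j; rewrite /xr mem_index_enum.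
Qed.

(** A continuous multilinear map is bounded near the origin, hence, by
   homogeneity in each variable, by a multiple of the product of the norms. *)
Lemma multilinear_bounded T : cont_multilinear T ->
  exists2 M, 0 <= M & forall x, rnorm (T x) <= M * \prod_(i < n) rnorm (x i).
Proof.
move=> [mT cT].
pose box (e : R) : set (forall i, E i) := [set x | forall i, rnorm (x i) < e].
have [e e0 Te] : exists2 e : R, 0 < e &
    forall x, box e x -> `|T (fun=> 0) - T x| < 1.
  pose G := filter_from [set e : R | 0 < e] box.
  have FG : Filter G.
    apply: filter_from_filter; first by exists 1; exact: ltr01.
    move=> i j /= i0 j0; exists (Num.min i j); first by rewrite /= lt_min i0.
    by move=> x xij; split=> k; have := xij k; rewrite lt_min => /andP[].
  have cG : G --> ((fun=> 0) : prod_topology E).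
    apply: cvg_prod_topology => i; apply/cvgr0Pnorm_lt => e e0.
    exists (scalar_re e); first exact: scalar_re_gt0.
    by move=> x xe; rewrite /= norm_lt_rnorm.
  have : T @ G --> T (fun=> 0) by exact: cvg_trans (cvg_app T cG) (cT (fun=> 0)).
  by move=> /cvgrPdist_lt/(_ 1 ltr01) [e e0 eT]; exists e => // x xe; exact: eT.
pose c : K := of_real s (e / 2).
have c0 : c != 0 by apply/eqP => /of_real_eq0 /eqP; rewrite gt_eqF // divr_gt0.
have rc : rnorm (c : K^o) = e / 2 by rewrite rnorm_of_real // divr_ge0 // ltW.
exists (rnorm (c^-1 : K^o) ^+ n * (rnorm (T (fun=> 0)) + 1)).
  by rewrite mulr_ge0 ?exprn_ge0 ?addr_ge0 ?rnorm_ge0.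
move=> x.
have [/existsP[i /eqP xi0]|/existsPn x0] := boolP [exists i, x i == 0].
  rewrite (multilinear_eq0 mT xi0) rnorm0 mulr_ge0 ?prodr_ge0 //.
    by rewrite mulr_ge0 ?exprn_ge0 ?addr_ge0 ?rnorm_ge0.
  by move=> j _; exact: rnorm_ge0.
(* rescale every coordinate of x to norm e / 2 *)
pose y i := c *: (`|x i|^-1 *: x i).
have xE : x = fun i => (c^-1 * `|x i|) *: y i.
  apply: functional_extensionality_dep => i; rewrite /y !scalerA.
  by rewrite [c^-1 * _ * c]mulrAC (mulVf c0) mul1r mulfV ?normr_eq0 ?x0 // scale1r.
have Ty : rnorm (T y) <= rnorm (T (fun=> 0)) + 1.
  have yb : box e y.
    move=> i; rewrite /y rnormZ rnorm_normalize ?x0 // mulr1 rc.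
    by rewrite ltr_pdivrMr // mulr_natr mulr2n ltrDl.
  have := Te _ yb; rewrite norm_lt_rnorm // scalar_re1 => /ltW T01.
  by rewrite -[T y](subKr (T (fun=> 0))) (le_trans (rnormD _ _)) // rnormN lerD2l.
rewrite {1}xE multilinearZ // rnormZ rnorm_prod.
under eq_bigr do rewrite rnormM rnorm_norm.
rewrite big_split prodr_const card_ord /= mulrAC ler_wpM2r //.
  by apply: prodr_ge0 => i _; exact: rnorm_ge0.
by rewrite ler_wpM2l // exprn_ge0 // rnorm_ge0.
Qed.


Lemma multilinear_unit_bounded T (M : R) : multilinear T ->
  (forall x, (forall i, rnorm (x i) <= 1) -> rnorm (T x) <= M) ->
  forall x, rnorm (T x) <= M * \prod_(i < n) rnorm (x i).
Proof.
move=> mT TM x.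
have M0 : 0 <= M.
  apply: le_trans (TM (fun=> 0) _); first exact: rnorm_ge0.
  by move=> i; rewrite rnorm0.
have [/existsP[i /eqP xi0]|/existsPn x0] := boolP [exists i, x i == 0].
  rewrite (multilinear_eq0 mT xi0) rnorm0 mulr_ge0 ?prodr_ge0 // => j _.
  exact: rnorm_ge0.
have -> : x = fun i => `|x i| *: (`|x i|^-1 *: x i).
  apply: functional_extensionality_dep => i.
  by rewrite scalerA mulfV ?normr_eq0 ?x0 // scale1r.
rewrite multilinearZ // rnormZ rnorm_prod mulrC.
under [in leRHS]eq_bigr do rewrite rnormZ rnorm_normalize ?x0 // mulr1.
rewrite ler_wpM2r ?prodr_ge0 // => [i _|]; first exact: rnorm_ge0.
by apply: TM => i; rewrite rnorm_normalize ?x0.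
Qed.

Lemma ml_norm_set_neq0 T :
  [set rnorm (T x) | x in [set x : forall i, E i | forall i, rnorm (x i) <= 1]]
    !=set0.
Proof. by exists (rnorm (T (fun=> 0))); exists (fun=> 0) => // i; rewrite rnorm0. Qed.

Lemma ml_norm_ub T x : cont_multilinear T -> (forall i, rnorm (x i) <= 1) ->
  rnorm (T x) <= ml_norm T.
Proof.
move=> cT x1; apply: ub_le_sup; last by exists x.
have [M M0 TM] := multilinear_bounded cT.
exists M => _ [y y1 <-]; rewrite (le_trans (TM y)) // ler_piMr // prodr_ile1 // => i _.
by rewrite rnorm_ge0 y1.
Qed.

Lemma ml_norm_bound T : cont_multilinear T ->
  forall x, rnorm (T x) <= ml_norm T * \prod_(i < n) rnorm (x i).
Proof.
move=> cT; apply: multilinear_unit_bounded; first by case: cT.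
by move=> x; exact: ml_norm_ub.
Qed.

Lemma ml_norm_le T (M : R) : 0 <= M ->
  (forall x, rnorm (T x) <= M * \prod_(i < n) rnorm (x i)) -> ml_norm T <= M.
Proof.
move=> M0 TM; apply: ge_sup; first exact: ml_norm_set_neq0.
move=> _ [y y1 <-]; rewrite (le_trans (TM y)) // ler_piMr // prodr_ile1 // => i _.
by rewrite rnorm_ge0 y1.
Qed.

End Fixed.
End Multilinear.

(** * Operations on continuous multilinear maps *)

Section Constructions.
Context (R : realType) (s : scalar_kind).
Notation K := (scalars R s).
Notation banach := (completeNormedModType K).

Lemma linear_additive0 (V W : lmodType K) (u : V -> W) : linear u -> u 0 = 0.
Proof. by move=> /(_ (-1) 0 0); rewrite scaler0 addr0 scaleN1r addNr. Qed.

Lemma linear_mapZ (V W : lmodType K) (u : V -> W) a x :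
  linear u -> u (a *: x) = a *: u x.
Proof. by move=> lu; have := lu a x 0; rewrite (linear_additive0 lu) !addr0. Qed.

Lemma linear_map_sum (V W : lmodType K) (u : V -> W) (J : Type) (r : seq J)
    (f : J -> V) : linear u ->
  u (\sum_(j <- r) f j) = \sum_(j <- r) u (f j).
Proof.
move=> lu; apply: big_morph; last exact: linear_additive0.
by move=> y z; have := lu 1 y z; rewrite !scale1r.
Qed.

Lemma dfwith_lift (I : eqType) (J : eqType) (T : I -> Type) (h : J -> I)
    (x : forall i, T i) j (y : T (h j)) : injective h ->
  (fun k => dfwith x (h j) y (h k)) = dfwith (fun k => x (h k)) j y.
Proof.
move=> hI; apply: functional_extensionality_dep => k.
case: (dfwithP (fun k => x (h k)) y) => [|{}k jk]; first by rewrite dfwithin.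
by rewrite dfwithout // (inj_eq hI).
Qed.

Section Multi.
Context (n : nat) (E : 'I_n -> banach).

Lemma cont_multilinear_comp (G : 'I_n -> banach) (F H : normedModType K)
    (u : forall i, G i -> E i) (T : (forall i, E i) -> F) (v : F -> H) :
  (forall i, cont_linear (u i)) -> cont_multilinear T -> cont_linear v ->
  cont_multilinear (fun x : forall i, G i => v (T (fun i => u i (x i)))).
Proof.
move=> cu [mT cT] [lv cv]; split.
  move=> x i a y z.
  have uE w : (fun j => u j (dfwith x i w j)) = dfwith (fun j => u j (x j)) i (u i w).
    apply: functional_extensionality_dep => j.
    by case: (dfwithP (fun j => u j (x j))) => [|{}j ij]; rewrite ?dfwithin ?dfwithout.
  by rewrite !uE (cu i).1 mT lv.
move=> x.
apply: (@continuous_comp (prod_topology G) _ _ (fun x => T (fun i => u i (x i))) v);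
  last exact: cv.
apply: (@continuous_comp (prod_topology G) (prod_topology E)
   _ (fun x i => u i (x i)) T); last exact: cT.
apply: continuous_prod_topology => i {}x.
apply: (@continuous_comp (prod_topology G) _ _ (fun x => x i) (u i)).
  exact: continuous_coord.
exact: (cu i).2.
Qed.

Lemma cont_multilinear0 (F : normedModType K) :
  cont_multilinear (0 : (forall i, E i) -> F).
Proof.
split; first by move=> x i a y z; rewrite /= scaler0 addr0.
exact: (@cst_continuous (prod_topology E) F 0).
Qed.

Lemma cont_multilinearP (F : normedModType K) (a : K) (T U : (forall i, E i) -> F) :
  cont_multilinear T -> cont_multilinear U -> cont_multilinear (a *: T + U).
Proof.
move=> [mT cT] [mU cU]; split.
  move=> x i b y z; rewrite !fctE mT mU !scalerDr !scalerA [a * b]mulrC.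
  by rewrite addrACA.
move=> x; apply: (@continuousD K F (prod_topology E) (a *: T) U); last exact: cU.
by apply: (@continuousZl_tmp K F (prod_topology E) T a); exact: cT.
Qed.

Lemma multilinear_prod (g : forall i, E i -> K^o) : (forall i, linear (g i)) ->
  multilinear (fun x => \prod_(i < n) g i (x i) : K^o).
Proof.
move=> lg x i a y z.
have prodE w : \prod_(j < n) g j (dfwith x i w j) =
    g i w * \prod_(j < n | j != i) g j (x j).
  rewrite (bigD1 i) //= dfwithin; congr (_ * _).
  by apply: eq_bigr => j ji; rewrite dfwithout // eq_sym.
by rewrite !prodE lg mulrDl -scalerAl.
Qed.

Lemma cont_multilinear_prod (g : forall i, E i -> K^o) :
  (forall i, cont_linear (g i)) ->
  cont_multilinear (fun x => \prod_(i < n) g i (x i) : K^o).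
Proof.
move=> cg; split; first by apply: multilinear_prod => i; case: (cg i).
apply: (@continuous_big (K^o : topologicalType) _ *%R 1 xpredT (@mul_continuous K)
  (prod_topology E) _ (fun i x => g i (x i))) => i _ x.
apply: (@continuous_comp (prod_topology E) _ _ (fun x => x i) (g i)).
  exact: continuous_coord.
exact: (cg i).2.
Qed.

Lemma cont_multilinear_scale (F : normedModType K) (c : (forall i, E i) -> K^o)
    (b : F) : cont_multilinear c -> cont_multilinear (fun x => c x *: b).
Proof.
move=> [mc cc]; split; first by move=> x i a y z; rewrite mc scalerDl scalerA.
by move=> x; apply: (@continuousZr_tmp K F (prod_topology E) c); exact: cc.
Qed.

Lemma cont_linear_coord (F : normedModType K) (T : (forall i, E i) -> F) k
    (a : forall i, E i) :
  cont_multilinear T -> cont_linear (fun x : E k => T (dfwith a k x)).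
Proof.
move=> [mT cT]; split; first by move=> c x y; exact: mT.
move=> x; apply: (@continuous_comp _ (prod_topology E) _ (dfwith a k) T).
  exact: dfwith_continuous.
exact: cT.
Qed.

End Multi.

Lemma cont_multilinear_diag n (E : banach) (F : normedModType K)
    (A : ('I_n -> E) -> F) :
  cont_multilinear (E := fun=> E) A -> cont_poly n (fun x => A (fun=> x)).
Proof.
move=> [mA cA]; split; first by exists A.
move=> x; apply: (@continuous_comp _ (prod_topology (fun _ : 'I_n => E)) _
  (fun x => fun=> x) A); last exact: cA.
by apply: continuous_prod_topology => i {}x; exact: cvg_id.
Qed.

Section Lift.
Context (k : nat) (E : 'I_k.+1 -> banach) (j : 'I_k.+1).
Notation E' := (fun i : 'I_k => E (lift j i)).

(** Changing the i-th free variable is changing the variable of index lift j i. *)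
Lemma insert_at_dfwith (a : E j) (x : forall i, E' i) i y :
  insert_at (E := fun l => E l) a (dfwith x i y) =
  dfwith (T := fun l => E l) (insert_at a x) (lift j i) y.
Proof.
apply: functional_extensionality_dep => l; case: (unliftP j l) => [i' ->|->].
  rewrite insert_at_lift; have := @dfwith_lift _ _ (fun l => E l) (lift j)
    (insert_at (E := fun l => E l) a x) i y (@lift_inj _ j).
  move=> /(congr1 (@^~ i')) /= ->.
  rewrite (_ : (fun l' => _) = x) //.
  by apply: functional_extensionality_dep => l'; rewrite insert_at_lift.
by rewrite insert_at_same dfwithout ?insert_at_same // eq_sym neq_lift.
Qed.

Lemma cont_multilinear_insert (F : normedModType K) (T : (forall i, E i) -> F)
    (a : E j) : cont_multilinear T ->
  cont_multilinear (E := E') (fun x => T (insert_at a x)).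
Proof.
move=> [mT cT]; split; first by move=> x i b y z; rewrite !insert_at_dfwith.
move=> x; apply: (@continuous_comp (prod_topology E') (prod_topology E) _
  (fun x => insert_at a x) T); last exact: cT.
apply: continuous_prod_topology => l {}x.
case: (unliftP j l) => [i ->|->].
  rewrite (_ : (fun x => _) = (fun x : prod_topology E' => x i)).
    exact: (@continuous_coord _ E').
  by apply/funext => y; rewrite insert_at_lift.
rewrite (_ : (fun x => _) = (fun=> a)).
  exact: (@cst_continuous (prod_topology E') (E j) a).
by apply/funext => y; rewrite insert_at_same.
Qed.

Lemma continuous_lift :
  continuous (fun (x : prod_topology E) => (fun i => x (lift j i)) : prod_topology E').
Proof.
by apply: continuous_prod_topology => i; exact: continuous_coord.
Qed.

(** The product of a multilinear map of the variables other than the j-th one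
   and of a linear map of the j-th variable, for a given bilinear product. *)
Lemma multilinear_lift_mul (V W F : normedModType K) (op : V -> W -> F)
    (A : (forall i, E' i) -> V) (u : E j -> W) :
  (forall v, linear (op v)) -> (forall w, linear (op^~ w)) ->
  multilinear (E := E') A -> linear u ->
  multilinear (fun x => op (A (fun i => x (lift j i))) (u (x j))).
Proof.
move=> opl opr mA lu x l a y z; case: (unliftP j l) y z => [i ->|->] y z.
  rewrite !dfwithout 1?eq_sym ?neq_lift //.
  by rewrite !(@dfwith_lift _ _ (fun l => E l) (lift j) x i _ (@lift_inj _ j)) mA opr.
have out w : (fun i => dfwith x j w (lift j i)) = (fun i => x (lift j i)).
  by apply: functional_extensionality_dep => i; rewrite dfwithout ?neq_lift.
by rewrite !out !dfwithin lu opl.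
Qed.

Lemma cont_multilinear_lift_mulr (F : normedModType K)
    (A : (forall i, E' i) -> F) (g : E j -> K^o) :
  cont_multilinear (E := E') A -> cont_linear g ->
  cont_multilinear (fun x => g (x j) *: A (fun i => x (lift j i))).
Proof.
move=> [mA cA] [lg cg]; split.
  apply: (@multilinear_lift_mul F K^o F (fun v c => c *: v)) => //.
    by move=> v a c d; rewrite scalerDl scalerA.
  by move=> c a v w; rewrite scalerDr !scalerA mulrC.
move=> x; apply: (@continuousZ K F (prod_topology E) (fun x => g (x j))).
  apply: (@continuous_comp (prod_topology E) _ _ (fun x => x j) g); last exact: cg.
  exact: continuous_coord.
apply: (@continuous_comp (prod_topology E) (prod_topology E') _
  (fun x i => x (lift j i)) A); last exact: cA.
exact: continuous_lift.
Qed.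

Lemma cont_multilinear_lift_mull (F : normedModType K)
    (c : (forall i, E' i) -> K^o) (u : E j -> F) :
  cont_multilinear (E := E') c -> cont_linear u ->
  cont_multilinear (fun x => c (fun i => x (lift j i)) *: u (x j)).
Proof.
move=> [mc cc] [lu cu]; split.
  apply: (@multilinear_lift_mul K^o F F *:%R) => //.
    by move=> c' a v w; rewrite scalerDr !scalerA mulrC.
  by move=> v a c' d; rewrite scalerDl scalerA.
move=> x; apply: (@continuousZ K F (prod_topology E)
  (fun x => c (fun i => x (lift j i)))).
  apply: (@continuous_comp (prod_topology E) (prod_topology E') _
    (fun x i => x (lift j i)) c); last exact: cc.
  exact: continuous_lift.
apply: (@continuous_comp (prod_topology E) _ _ (fun x => x j) u); last exact: cu.
exact: continuous_coord.
Qed.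

End Lift.
End Constructions.

(** * The polarization formula *)

Section Polarization.
Context (R : realType) (s : scalar_kind).
Notation K := (scalars R s).
Notation banach := (completeNormedModType K).
Context (n : nat) (E : banach) (F : normedModType K).
Implicit Types (A : ('I_n -> E) -> F) (x y : 'I_n -> E).

(** Expansion of a multilinear map at a diagonal point that is a sum. *)
Lemma multilinear_diag_sum A y : multilinear (E := fun=> E) A ->
  A (fun=> \sum_j y j) = \sum_(f : {ffun 'I_n -> 'I_n}) A (fun i => y (f i)).
Proof.
move=> mA.
(* the variables in r hold the whole sum, the others the terms chosen by g *)
pose mix (r : seq 'I_n) (g : {ffun 'I_n -> 'I_n}) i :=
  if i \in r then \sum_j y j else y (g i).
have expand (r : seq 'I_n) : uniq r -> forall g, A (mix r g) =
    \sum_(f : {ffun 'I_n -> 'I_n} | [forall i, (i \notin r) ==> (f i == g i)])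
      A (fun i => y (f i)).
  elim: r => [_ g|k r IH /= /andP[kr ur] g].
    rewrite (big_pred1 g) // => f; apply/forallP/eqP => [fg|->].
      by apply/ffunP => i; apply/eqP; exact: fg.
    by move=> i; rewrite eqxx implybT.
  have -> : mix (k :: r) g = dfwith (T := fun=> E) (mix r g) k (\sum_j y j).
    apply/funext => i; case: (dfwithP (T := fun=> E) (mix r g)) => [|{}i ki].
      by rewrite /mix mem_head.
    by rewrite /mix in_cons eq_sym (negbTE ki).
  rewrite (multilinear_coord_sum (E := fun=> E)) //.
  rewrite (partition_big (fun f : {ffun 'I_n -> 'I_n} => f k) xpredT) //=.
  apply: eq_bigr => j _.
  pose gj := [ffun i => if i == k then j else g i].
  have -> : dfwith (T := fun=> E) (mix r g) k (y j) = mix r gj.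
    apply/funext => i; case: (dfwithP (T := fun=> E) (mix r g)) => [|{}i ki].
      by rewrite /mix (negbTE kr) ffunE eqxx.
    by rewrite /mix ffunE eq_sym (negbTE ki).
  rewrite IH //; apply: eq_bigl => f.
  apply/forallP/andP => [fg|[/forallP fg /eqP fk] i].
    split; last by have := fg k; rewrite kr ffunE eqxx.
    apply/forallP => i; have := fg i; rewrite ffunE in_cons.
    by have [->|//] := eqVneq i k.
  have := fg i; rewrite ffunE in_cons.
  by have [->|//] := eqVneq i k; rewrite fk eqxx implybT.
have := expand (index_enum 'I_n) (index_enum_uniq _) [ffun i => i].
have -> : mix (index_enum 'I_n) [ffun i => i] = fun=> \sum_j y j.
  by apply/funext => i; rewrite /mix mem_index_enum.
move=> ->; apply: eq_bigl => f; apply/forallP => i.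
by rewrite mem_index_enum.
Qed.

(** A vertex b of the discrete cube stands for the subset of the indices i such
   that b i; its sign is (-1) to the number of indices outside that subset. *)
Definition cube_sign (b : {ffun 'I_n -> bool}) : K :=
  \prod_(i < n) (if b i then 1 else -1).

(** The sum of the x i over the subset b. *)
Definition cube_point (b : {ffun 'I_n -> bool}) x : E :=
  \sum_(i < n) (b i)%:R *: x i.

(** Inclusion-exclusion: for a map f of the index set to itself, only the
   subsets containing the image of f have a nonzero product, and their signs add
   up to 0 unless f is surjective, that is, injective. *)
Lemma sum_cube_sign (f : {ffun 'I_n -> 'I_n}) :
  \sum_(b : {ffun 'I_n -> bool}) cube_sign b * \prod_(k < n) (b (f k))%:R =
  (injectiveb f)%:R.
Proof.
(* group the factors of the product according to the value of f *)
pose c i (e : bool) : K :=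
  (if e then 1 else -1) * \prod_(k < n | f k == i) e%:R.
transitivity (\prod_(i < n) \sum_(e : bool) c i e).
  rewrite bigA_distr_bigA; apply: eq_bigr => b _; rewrite /c big_split /=.
  congr (_ * _); rewrite (partition_big f xpredT) //=.
  by apply: eq_bigr => i _; apply: eq_bigr => k /eqP ->.
have cE i : \sum_(e : bool) c i e = ([exists k, f k == i])%:R.
  rewrite big_bool /c /= mul1r big1 // mulN1r.
  case: existsP => [[k fk]|nk]; first by rewrite (bigD1 k) //= mul0r subr0.
  rewrite big_pred0 ?subrr // => k; apply/negbTE/negP => fk.
  by apply: nk; exists k.
under eq_bigr do rewrite cE.
have [/injectiveP f_inj|f_ninj] := boolP (injectiveb f).
  rewrite big1 // => i _; have [g fg gf] := injF_bij f_inj.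
  by rewrite (_ : [exists k, _]) //; apply/existsP; exists (g i); rewrite gf.
have [i nfi] : exists i, ~~ [exists k, f k == i].
  apply/existsP; apply: contraNT f_ninj; rewrite negb_exists => /forallP fsurj.
  have /image_injP f_inj : #|[seq f k | k in 'I_n]| == #|'I_n|.
    apply/eqP/eq_card => i; rewrite inE; have := fsurj i.
    by rewrite negbK => /existsP[k /eqP <-]; rewrite fintype.image_f.
  by apply/injectiveP => k l; exact: f_inj.
by rewrite (bigD1 i) //= (negbTE nfi) mul0r.
Qed.

(** The maps f that are not permutations cancel out of the expansions of A at the
   points of the cube. *)
Lemma polarization A x : multilinear (E := fun=> E) A ->
  \sum_(b : {ffun 'I_n -> bool}) cube_sign b *: A (fun=> cube_point b x) =
  \sum_(t : 'S_n) A (x \o t).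
Proof.
move=> mA.
transitivity (\sum_(f : {ffun 'I_n -> 'I_n}) (injectiveb f)%:R *: A (x \o f)).
  under eq_bigr do rewrite /cube_point multilinear_diag_sum // scaler_sumr.
  rewrite exchange_big /=; apply: eq_bigr => f _.
  rewrite -sum_cube_sign scaler_suml; apply: eq_bigr => b _.
  by rewrite (multilinearZ (E := fun=> E) (fun i => (b (f i))%:R) (x \o f)) // scalerA.
rewrite (bigID (fun f : {ffun 'I_n -> 'I_n} => injectiveb f)) /= addrC.
rewrite big1 => [|f /negbTE ->].
  rewrite add0r (reindex (@pval _)) /=; last first.
    pose in_Sn := insubd (1%g : 'S_n).
    by exists in_Sn => /= f Uf; first apply: val_inj; apply: insubdK.
  apply: eq_big => /= [t|t _]; rewrite ?(valP t) // scale1r.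
  by congr A; apply/funext => i /=; rewrite -pvalE.
by rewrite scale0r.
Qed.

End Polarization.

#[global] Arguments cube_sign {R} s {n} b.

(** * Continuous homogeneous polynomials *)

Section Polynomials.
Context (R : realType) (s : scalar_kind).
Notation K := (scalars R s).
Notation banach := (completeNormedModType K).

Lemma continuous_scale_sum (X : topologicalType) (J : finType) (V : normedModType K)
    (c : K) (f : J -> X -> V) :
  (forall j, continuous (f j)) -> continuous (fun x => c *: \sum_j f j x).
Proof.
move=> cf x; apply: (@continuousZl_tmp K V X (fun x => \sum_j f j x)).
have cS : continuous (fun x => \sum_j f j x).
  by apply: continuous_big => // ; exact: add_continuous.
exact: cS.
Qed.

Section Polar.
Context (n : nat) (E : banach) (F : normedModType K).
Implicit Types (P : E -> F).

Lemma fact_neq0 : (n`!)%:R != 0 :> K.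
Proof. by rewrite pnatr_eq0 -lt0n fact_gt0. Qed.

(** The symmetrization of a form defining P is continuous because polarization
   writes it in terms of the values of P. *)
Lemma symmetric_form_exists P : cont_poly n P -> exists A : ('I_n -> E) -> F,
  [/\ cont_multilinear (E := fun=> E) A, symmetric_map A &
      forall x, A (fun=> x) = P x].
Proof.
move=> [[A0 mA0 PA0] cP].
pose X := prod_topology (fun _ : 'I_n => E : topologicalType).
pose A (x : 'I_n -> E) : F := (n`!)%:R^-1 *: \sum_b cube_sign s b *: P (cube_point b x).
have AE (x : 'I_n -> E) : A x = (n`!)%:R^-1 *: \sum_(t : 'S_n) A0 (x \o t).
  rewrite -polarization // /A.
  by congr (_ *: _); apply: eq_bigr => b _; rewrite PA0.
exists A; split; first split.
- have dfE x i y (t : 'S_n) : dfwith (T := fun=> E) x i y \o t =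
      dfwith (T := fun=> E) (x \o t) (t^-1 i)%g y.
    apply/funext => k /=; case: (dfwithP (T := fun=> E) (x \o t)) => [|{}k ki].
      by rewrite permKV dfwithin.
    by rewrite dfwithout // -(inj_eq (@perm_inj _ t^-1%g)) permK.
  move=> x i a y z; rewrite !AE scalerA [a * _]mulrC -scalerA -scalerDr.
  congr (_ *: _); rewrite scaler_sumr -big_split /=.
  by apply: eq_bigr => t _; rewrite !dfE mA0.
- apply: (@continuous_scale_sum _ _ F _
    (fun b (x : X) => cube_sign s b *: P (cube_point b x))).
  move=> b x; apply: (@continuousZl_tmp K F X (fun x => P (cube_point b x))).
  apply: (@continuous_comp X _ _ (cube_point b) P); last exact: cP.
  have -> : cube_point b = fun x : X => 1 *: \sum_i (b i)%:R *: x i.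
    by apply/funext => y; rewrite scale1r.
  apply: (@continuous_scale_sum _ _ E _ (fun i (x : X) => (b i)%:R *: x i)).
  move=> i {}x; apply: (@continuousZl_tmp K E X (fun x => x i)).
  exact: continuous_coord.
- move=> t x; rewrite !AE; congr (_ *: _).
  rewrite [RHS](reindex_inj (mulIg t)); apply: eq_bigr => t' _ /=.
  by congr A0; apply/funext => k /=; rewrite permM.
- move=> x; rewrite AE (eq_bigr (fun=> P x)) => [|t _]; last by rewrite PA0.
  by rewrite sumr_const card_Sn -[P x *+ _]scaler_nat scalerA mulVf ?fact_neq0 // scale1r.
Qed.

Lemma polarP P : cont_poly n P ->
  [/\ cont_multilinear (E := fun=> E) (polar n P), symmetric_map (polar n P) &
      forall x, polar n P (fun=> x) = P x].
Proof. by move=> /symmetric_form_exists /(xgetPex (fun=> 0)). Qed.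

Lemma polar_formula P (x : 'I_n -> E) : cont_poly n P -> polar n P x =
  \sum_b ((n`!)%:R^-1 * cube_sign s b) *: P (cube_point b x).
Proof.
move=> /polarP[[mA _] sA PA].
under eq_bigr do rewrite -scalerA -PA.
rewrite -scaler_sumr polarization // (eq_bigr (fun=> polar n P x)) //.
rewrite sumr_const card_Sn -[polar n P x *+ _]scaler_nat scalerA.
by rewrite mulVf ?fact_neq0 // scale1r.
Qed.

Lemma cont_polyZ P a x : cont_poly n P -> P (a *: x) = a ^+ n *: P x.
Proof.
move=> /polarP[[mA _] _ PA]; rewrite -!PA.
by rewrite (multilinearZ (E := fun=> E) (fun=> a)) // prodr_const card_ord.
Qed.

Lemma cont_poly_bounded P : cont_poly n P ->
  exists2 M, 0 <= M & forall x, rnorm (P x) <= M * rnorm x ^+ n.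
Proof.
move=> /polarP[cA _ PA]; have [M M0 AM] := multilinear_bounded cA.
exists M => // x; rewrite -PA (le_trans (AM _)) //.
by rewrite prodr_const card_ord.
Qed.

Lemma map_norm_ub P x : cont_poly n P -> rnorm x <= 1 ->
  rnorm (P x) <= map_norm P.
Proof.
move=> cP x1; apply: ub_le_sup; last by exists x.
have [M M0 PM] := cont_poly_bounded cP.
exists M => _ [y y1 <-]; rewrite (le_trans (PM y)) // ler_piMr //.
by rewrite exprn_ile1 // rnorm_ge0.
Qed.

Lemma map_norm_ge0 P : cont_poly n P -> 0 <= map_norm P.
Proof.
by move=> cP; rewrite (le_trans (rnorm_ge0 _) (@map_norm_ub _ 0 cP _)) ?rnorm0.
Qed.

Lemma map_norm_bound P x : cont_poly n P ->
  rnorm (P x) <= map_norm P * rnorm x ^+ n.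
Proof.
move=> cP; have [->|x0] := eqVneq x 0.
  have := cont_polyZ 0 0 cP; rewrite scaler0 => ->.
  rewrite rnormZ rnormX !rnorm0; have [->|n0] := posnP n.
    by rewrite !expr0 mul1r mulr1 map_norm_ub // rnorm0.
  by rewrite expr0n gtn_eqF // mul0r mulr0.
rewrite -{1}[x]scale1r -(mulfV (_ : `|x| != 0)) ?normr_eq0 // -scalerA.
rewrite (cont_polyZ _ _ cP) rnormZ rnormX rnorm_norm mulrC.
by rewrite ler_wpM2r ?exprn_ge0 ?rnorm_ge0 // map_norm_ub // rnorm_normalize.
Qed.

Lemma map_norm_le P (M : R) : 0 <= M ->
  (forall x, rnorm (P x) <= M * rnorm x ^+ n) -> map_norm P <= M.
Proof.
move=> M0 PM; apply: ge_sup; first by exists (rnorm (P 0)), 0; rewrite /= ?rnorm0.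
move=> _ [y y1 <-]; rewrite (le_trans (PM y)) // ler_piMr //.
by rewrite exprn_ile1 // rnorm_ge0.
Qed.

Lemma cont_poly0 : cont_poly n (0 : E -> F).
Proof.
split; last exact: (@cst_continuous E F 0).
exists (0 : ('I_n -> E) -> F) => //.
exact: (@cont_multilinear0 _ _ n (fun=> E) F).1.
Qed.

Lemma cont_polyP a P Q : cont_poly n P -> cont_poly n Q ->
  cont_poly n (a *: P + Q).
Proof.
move=> cP cQ; have [cA _ PA] := polarP cP; have [cB _ QB] := polarP cQ.
have := cont_multilinear_diag (cont_multilinearP a cA cB).
by congr cont_poly; apply/funext => x; rewrite !fctE PA QB.
Qed.

End Polar.

(** The polarization formula has 2 ^ n terms, and when the vectors x i have norm at
   most 1, each of them is, up to sign, a value of q at a vector of norm at most n,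
   divided by n!. *)
Lemma polar_norm_le n (E : banach) (q : E -> K^o) : cont_poly n q ->
  map_norm q <= 1 -> forall x : 'I_n -> E,
  rnorm (polar n q x) <=
  (rnorm ((n`!)%:R^-1 : K^o) * (2 ^ n)%:R * n%:R ^+ n) * \prod_(i < n) rnorm (x i).
Proof.
move=> cq q1; have [[mA _] _ _] := polarP cq.
apply: (multilinear_unit_bounded (E := fun=> E)) => // x x1.
have sign1 (b : {ffun 'I_n -> bool}) : rnorm (cube_sign s b : K^o) = 1.
  rewrite /cube_sign rnorm_prod big1 // => i _.
  by case: (b i); rewrite ?rnormN rnorm1.
have point_le b : rnorm (cube_point b x) <= n%:R.
  rewrite /cube_point (le_trans (rnorm_sum _ _)) //.
  rewrite -[n in n%:R]card_ord -sumr_const ler_sum // => i _.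
  rewrite rnormZ; case: (b i); rewrite ?rnorm1 ?mul1r //.
  by rewrite rnorm0 mul0r.
rewrite polar_formula // (le_trans (rnorm_sum _ _)) //.
rewrite -mulrA; apply: (@le_trans _ _ (\sum_(b : {ffun 'I_n -> bool})
    rnorm ((n`!)%:R^-1 : K^o) * n%:R ^+ n)).
  apply: ler_sum => b _; rewrite rnormZ rnormM sign1 mulr1.
  rewrite ler_wpM2l ?rnorm_ge0 // (le_trans (map_norm_bound _ cq)) //.
  rewrite (le_trans (ler_wpM2r _ q1)) ?exprn_ge0 ?rnorm_ge0 // mul1r.
  by rewrite lerXn2r ?nnegrE ?rnorm_ge0.
rewrite sumr_const card_ffun card_bool card_ord -[_ *+ (2 ^ n)%N]mulr_natl.
by rewrite mulrCA.
Qed.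

Section Constructions.
Context (E F : banach).

Lemma cont_poly_comp n (G H : banach) (u : G -> E) (P : E -> F) (v : F -> H) :
  cont_linear u -> cont_poly n P -> cont_linear v ->
  cont_poly n (v \o P \o u).
Proof.
move=> cu /polarP[cA _ PA] cv.
have := cont_multilinear_diag (cont_multilinear_comp (E := fun=> E)
  (G := fun=> G) (u := fun=> u) (fun=> cu) cA cv).
by congr cont_poly; apply/funext => x /=; rewrite PA.
Qed.

Lemma cont_poly_pow n (g : E -> K^o) (b : F) : cont_linear g ->
  cont_poly n (fun x => g x ^+ n *: b).
Proof.
move=> cg.
have := cont_multilinear_diag (cont_multilinear_scale b
  (cont_multilinear_prod (E := fun _ : 'I_n => E) (g := fun=> g) (fun=> cg))).
by congr cont_poly; apply/funext => x /=; rewrite prodr_const card_ord.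
Qed.

Lemma cont_poly_mul n (V : normedModType K) (g : E -> K^o) (P : E -> V) :
  cont_linear g -> cont_poly n P -> cont_poly n.+1 (fun x => g x *: P x).
Proof.
move=> cg /polarP[cA _ PA].
have := cont_multilinear_diag (cont_multilinear_lift_mulr (E := fun=> E)
  (j := ord_max) cA cg).
by congr cont_poly; apply/funext => x /=; rewrite PA.
Qed.

Lemma cont_poly1P (V : normedModType K) (u : E -> V) :
  cont_poly 1 u <-> cont_linear u.
Proof.
split=> [[[A mA uA] cu]|[lu cu]]; split=> //.
  move=> a y z.
  have uE x : u x = A (dfwith (T := fun=> E) (fun=> 0) ord0 x).
    rewrite uA; congr A; apply/funext => i; rewrite (ord1 i).
    by rewrite (dfwithin (T := fun=> E)).
  by rewrite !uE mA.
exists (fun x => u (x ord0)) => // x i a y z.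
by rewrite (ord1 i) !dfwithin lu.
Qed.

End Constructions.

End Polynomials.

(** * Domination by a class of forms *)

Section Domination.
Context (R : realType) (s : scalar_kind) (p : R) (hp : 1 <= p).
Notation K := (scalars R s).

(** A linear space of scalar functions on a set X, with a gauge on X, for instance
   the product of the norms of the variables, against which the functions are
   measured. *)
Record form_class (X : Type) := FormClass {
  fc_mem : set (X -> K^o);
  fc_gauge : X -> R;
  fc_mem0 : fc_mem 0;
  fc_memP : forall (a : K) phi psi,
    fc_mem phi -> fc_mem psi -> fc_mem (a *: phi + psi);
  fc_gauge_ge0 : forall x, 0 <= fc_gauge x }.

(** The functions of norm at most 1: those bounded by the gauge. *)
Definition form_ball X (Phi : form_class X) : set (X -> K^o) :=
  [set phi | fc_mem Phi phi /\ forall x, rnorm (phi x) <= fc_gauge Phi x].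

(** The p-norm of the norms of the linear combinations of values of T which have
   the coefficients l j i at the points x j i. *)
Definition comb_norm (X : Type) (F : normedModType K) (T : X -> F) m1 m2
    (x : 'I_m1 -> 'I_m2 -> X) (l : 'I_m1 -> 'I_m2 -> K) : R :=
  lp_norm p (fun j => rnorm (\sum_(i < m2) l j i *: T (x j i))).

(** The supremum of the p-norms of the same combinations of the forms of norm at
   most 1. *)
Definition weak_norm X (Phi : form_class X) m1 m2
    (x : 'I_m1 -> 'I_m2 -> X) (l : 'I_m1 -> 'I_m2 -> K) : R :=
  sup [set comb_norm phi x l | phi in form_ball Phi].

(** The inequality common to factorable strongly p-summing multilinear operators
   and polynomials, for which the class consists of the continuous multilinear
   forms, respectively of the continuous homogeneous polynomials. *)
Definition dom_bound X (Phi : form_class X) (F : normedModType K)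
    (T : X -> F) (C : R) : Prop :=
  forall m1 m2 : nat, (0 < m1)%N -> (0 < m2)%N ->
  forall (x : 'I_m1 -> 'I_m2 -> X) (l : 'I_m1 -> 'I_m2 -> K),
  comb_norm T x l <= C * weak_norm Phi x l.

(** The maps that satisfy such an inequality, for some constant. *)
Definition dominated X (Phi : form_class X) (F : normedModType K)
    (T : X -> F) : Prop := exists2 C, 0 <= C & dom_bound Phi T C.

(** The infimum of the constants in the inequality; it is 0 by convention when
   there are none. *)
Definition dom_size X (Phi : form_class X) (F : normedModType K)
    (T : X -> F) : R := inf [set C | 0 <= C /\ dom_bound Phi T C].

Section WeakNorm.
Context (X : Type) (Phi : form_class X).

Lemma fc_memZ a phi : fc_mem Phi phi -> fc_mem Phi (a *: phi).
Proof. by move=> m; rewrite -[a *: phi]addr0; apply: fc_memP => //; exact: fc_mem0. Qed.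

Lemma form_ball0 : form_ball Phi 0.
Proof.
by split; [exact: fc_mem0|move=> x; rewrite rnorm0; exact: fc_gauge_ge0].
Qed.

(** A form of norm at most c is c times a form of norm at most 1; the form 0 is
   used when c = 0. *)
Lemma form_normalize phi c : fc_mem Phi phi -> 0 <= c ->
  (forall x, rnorm (phi x) <= c * fc_gauge Phi x) ->
  exists2 psi, form_ball Phi psi & phi = of_real s c *: psi.
Proof.
move=> mphi; rewrite le_eqVlt => /predU1P[<-|c0] phic.
  exists 0; first exact: form_ball0.
  apply/funext => x; rewrite fctE scaler0; apply/rnorm0_eq0/le_anti.
  by rewrite rnorm_ge0 andbT (le_trans (phic x)) // mul0r.
have cK0 : of_real s c != 0 by apply/eqP => /of_real_eq0/eqP; rewrite gt_eqF.
exists ((of_real s c)^-1 *: phi); last by rewrite scalerA mulfV // scale1r.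
split; first exact: fc_memZ.
move=> x; rewrite fctE rnormZ -(ler_pM2l c0).
by rewrite mulrA -{1}(rnorm_of_real s (ltW c0)) -rnormM mulfV // rnorm1 mul1r.
Qed.

Section Points.
Context (m1 m2 : nat) (x : 'I_m1 -> 'I_m2 -> X) (l : 'I_m1 -> 'I_m2 -> K).

Lemma comb_norm_ge0 (F : normedModType K) (T : X -> F) : 0 <= comb_norm T x l.
Proof. exact: lp_norm_ge0. Qed.

Lemma weak_norm_ub phi : form_ball Phi phi -> comb_norm phi x l <= weak_norm Phi x l.
Proof.
move=> bphi; apply: ub_le_sup; last by exists phi.
exists (lp_norm p (fun j => \sum_i rnorm (l j i : K^o) * fc_gauge Phi (x j i))).
move=> _ [psi [_ psiB] <-]; apply: lp_norm_le => // j.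
rewrite rnorm_ge0 (le_trans (rnorm_sum _ _)) //; apply: ler_sum => i _.
by rewrite rnormZ ler_wpM2l ?rnorm_ge0.
Qed.

Lemma weak_norm_le M : (forall phi, form_ball Phi phi -> comb_norm phi x l <= M) ->
  weak_norm Phi x l <= M.
Proof.
move=> phiM; apply: ge_sup; last first.
  by move=> _ [phi bphi <-]; exact: phiM.
by exists (comb_norm (0 : X -> K^o) x l), 0 => //; exact: form_ball0.
Qed.

Lemma weak_norm_ge0 : 0 <= weak_norm Phi x l.
Proof. exact: le_trans (comb_norm_ge0 _) (weak_norm_ub form_ball0). Qed.

Lemma comb_normZ (F : normedModType K) a (T : X -> F) :
  comb_norm (a *: T) x l = rnorm (a : K^o) * comb_norm T x l.
Proof.
rewrite /comb_norm -(lp_normZ hp (rnorm_ge0 (a : K^o))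
  (fun j => rnorm_ge0 (\sum_i l j i *: T (x j i)))).
congr lp_norm; apply/funext => j; rewrite -rnormZ scaler_sumr; congr rnorm.
by apply: eq_bigr => i _; rewrite fctE !scalerA mulrC.
Qed.

Lemma comb_norm_comp (F G : normedModType K) (v : F -> G) (T : X -> F) d : 0 <= d ->
  linear v -> (forall z, rnorm (v z) <= d * rnorm z) ->
  comb_norm (v \o T) x l <= d * comb_norm T x l.
Proof.
move=> d0 lv vd; rewrite /comb_norm -(lp_normZ hp d0
  (fun j => rnorm_ge0 (\sum_i l j i *: T (x j i)))).
apply: lp_norm_le => // j; rewrite rnorm_ge0 (le_trans _ (vd _)) //.
rewrite (linear_map_sum _ _ lv) /=.
by under eq_bigr do rewrite -(linear_mapZ _ _ lv).
Qed.

End Points.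

Section Size.
Context (F : normedModType K).
Implicit Types T : X -> F.

Lemma dom_size_le T C : 0 <= C -> dom_bound Phi T C -> dom_size Phi T <= C.
Proof. by move=> C0 TC; apply: ge_inf => //; exists 0 => D []. Qed.

Lemma dom_size_ge0 T : 0 <= dom_size Phi T.
Proof.
rewrite /dom_size.
have [->|/set0P[C TC]] := eqVneq [set C | 0 <= C /\ dom_bound Phi T C] set0.
  by rewrite inf0.
by apply: lb_le_inf; [exists C|move=> D []].
Qed.

(** The infimum defining the norm is attained. *)
Lemma dom_sizeP T : dominated Phi T -> dom_bound Phi T (dom_size Phi T).
Proof.
move=> [C C0 TC] m1 m2 m10 m20 x l.
have := weak_norm_ge0 x l; rewrite le_eqVlt => /predU1P[W0|W0].
  by have := TC _ _ m10 m20 x l; rewrite -W0 !mulr0.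
rewrite -ler_pdivrMr //; apply: lb_le_inf; first by exists C.
by move=> D [_ TD]; rewrite ler_pdivrMr //; exact: TD.
Qed.

Lemma dominated_le T C : 0 <= C -> dom_bound Phi T C ->
  dominated Phi T /\ dom_size Phi T <= C.
Proof. by move=> C0 TC; split; [exists C|exact: dom_size_le]. Qed.

(** The inequality for a single combination of a single term. *)
Lemma dom_bound_pointwise T C x : 0 <= C -> dom_bound Phi T C ->
  rnorm (T x) <= C * fc_gauge Phi x.
Proof.
move=> C0 /(_ 1%N 1%N isT isT (fun _ _ => x) (fun _ _ => 1)).
have E1 (V : normedModType K) (U : X -> V) :
    @comb_norm _ _ U 1 1 (fun _ _ => x) (fun _ _ => 1) = rnorm (U x).
  by rewrite /comb_norm lp_norm1 // ?rnorm_ge0 // big_ord1 scale1r.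
rewrite E1 => /le_trans; apply; rewrite ler_wpM2l //.
by apply: weak_norm_le => phi [_ phiB]; rewrite E1.
Qed.

Lemma dom_bound0 : dom_bound Phi (0 : X -> F) 0.
Proof.
move=> m1 m2 _ _ x l; have := comb_normZ x l 0 (0 : X -> F).
by rewrite scale0r rnorm0 !mul0r => ->.
Qed.

Lemma dom_boundD T U C D : dom_bound Phi T C -> dom_bound Phi U D ->
  dom_bound Phi (T + U) (C + D).
Proof.
move=> TC UD m1 m2 m10 m20 x l.
apply: (@le_trans _ _ (comb_norm T x l + comb_norm U x l)); last first.
  by rewrite mulrDl lerD ?TC ?UD.
apply: le_trans (lp_normD hp _ _); try by move=> j; exact: rnorm_ge0.
apply: lp_norm_le => // j; rewrite rnorm_ge0 (le_trans _ (rnormD _ _)) //.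
rewrite -big_split /=.
by under [in leRHS]eq_bigr do rewrite -scalerDr.
Qed.

Lemma dom_boundZ a T C : dom_bound Phi T C ->
  dom_bound Phi (a *: T) (rnorm (a : K^o) * C).
Proof.
move=> TC m1 m2 m10 m20 x l; rewrite comb_normZ -mulrA ler_wpM2l ?rnorm_ge0 //.
exact: TC.
Qed.

Lemma dom_normed_subspace (adm : set (X -> F)) : adm 0 ->
  (forall a T U, adm T -> adm U -> adm (a *: T + U)) ->
  normed_subspace [set T | adm T /\ dominated Phi T] (@dom_size X Phi F).
Proof.
move=> adm0 admP; have size0 : dom_size Phi (0 : X -> F) = 0.
  by apply/le_anti; rewrite dom_size_ge0 dom_size_le //; exact: dom_bound0.
have sizeZ a T : dominated Phi T ->
    dom_size Phi (a *: T) <= rnorm (a : K^o) * dom_size Phi T.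
  move=> /dom_sizeP TC; apply: dom_size_le; last exact: dom_boundZ.
  by rewrite mulr_ge0 ?rnorm_ge0 ?dom_size_ge0.
have domZ a T : dominated Phi T -> dominated Phi (a *: T).
  move=> [C C0 TC]; exists (rnorm (a : K^o) * C); last exact: dom_boundZ.
  by rewrite mulr_ge0 ?rnorm_ge0.
split.
- by split=> //; exists 0 => //; exact: dom_bound0.
- move=> a T U [aT /(domZ a)[C C0 TC]] [aU [D D0 UD]]; split; first exact: admP.
  by exists (C + D); [exact: addr_ge0|exact: dom_boundD].
- by move=> T _; exact: dom_size_ge0.
- move=> T [_ /dom_sizeP TC] T0; apply/funext => x; apply/rnorm0_eq0/le_anti.
  rewrite rnorm_ge0 andbT (le_trans (dom_bound_pointwise x (dom_size_ge0 T) TC)) //.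
  by rewrite T0 mul0r.
- move=> a T [_ dT]; apply/le_anti; rewrite sizeZ //=.
  have [->|a0] := eqVneq a 0; first by rewrite rnorm0 mul0r dom_size_ge0.
  have ra0 : 0 < rnorm (a : K^o) by exact: rnorm_gt0.
  have := sizeZ a^-1 _ (domZ a _ dT); rewrite scalerA mulVf // scale1r.
  rewrite -(ler_pM2l ra0) mulrA -rnormM mulfV // rnorm1 mul1r.
  by [].
- move=> T U [_ dT] [_ dU]; apply: dom_size_le.
    by rewrite addr_ge0 ?dom_size_ge0.
  by apply: dom_boundD; exact: dom_sizeP.
Qed.

End Size.

(** A form times a vector is dominated. *)
Lemma dominated_rank1 (F : normedModType K) phi c (b : F) :
  fc_mem Phi phi -> 0 <= c -> (forall x, rnorm (phi x) <= c * fc_gauge Phi x) ->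
  dom_bound Phi (fun x => phi x *: b) (rnorm b * c).
Proof.
move=> mphi c0 phic m1 m2 m10 m20 x l.
have [psi bpsi phiE] := form_normalize mphi c0 phic.
apply: (@le_trans _ _ (rnorm b * comb_norm phi x l)).
  apply: (@comb_norm_comp m1 m2 x l K^o F (fun z => z *: b) phi).
    exact: rnorm_ge0.
    by move=> a y z; rewrite scalerDl scalerA.
  by move=> z; rewrite rnormZ mulrC.
rewrite -mulrA ler_wpM2l ?rnorm_ge0 // phiE comb_normZ rnorm_of_real //.
by rewrite ler_wpM2l // weak_norm_ub.
Qed.

End WeakNorm.

(** A form of norm at most 1 that attains the gauge 1 somewhere has norm 1. *)
Lemma dom_size_unit X (Phi : form_class X) phi x : fc_mem Phi phi ->
  (forall y, rnorm (phi y) <= fc_gauge Phi y) -> rnorm (phi x) = 1 ->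
  fc_gauge Phi x = 1 -> dom_size Phi phi = 1.
Proof.
move=> mphi phi1 phix gx; have bound1 : dom_bound Phi phi 1.
  have phic y : rnorm (phi y) <= 1 * fc_gauge Phi y by rewrite mul1r.
  have phiE : (fun y => phi y *: (1 : K^o)) = phi.
    by apply/funext => y; exact: mulr1.
  have := dominated_rank1 (1 : K^o) mphi ler01 phic.
  by rewrite phiE rnorm1 mulr1.
have dphi : dominated Phi phi by exists 1.
apply/le_anti; rewrite dom_size_le //= -phix.
apply: le_trans (dom_bound_pointwise x (dom_size_ge0 Phi phi) (dom_sizeP dphi)) _.
by rewrite gx mulr1.
Qed.

Section Transfer.
Context (X Y : Type) (Phi : form_class X) (Psi : form_class Y).

(** Combinations of combinations of values of T are combinations of values of T,
   indexed by pairs. *)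
Lemma comb_norm_expand (V : normedModType K) (T : X -> V) (I : finType)
    (w : I -> Y -> K) (h : I -> Y -> X) m1 m2
    (y : 'I_m1 -> 'I_m2 -> Y) (l : 'I_m1 -> 'I_m2 -> K) :
  comb_norm (fun y => \sum_t w t y *: T (h t y)) y l =
  comb_norm T
    (fun j (k : 'I_#|{: 'I_m2 * I}|) => h (enum_val k).2 (y j (enum_val k).1))
    (fun j k => l j (enum_val k).1 * w (enum_val k).2 (y j (enum_val k).1)).
Proof.
congr lp_norm; apply/funext => j; congr rnorm.
under eq_bigr do rewrite scaler_sumr.
rewrite pair_big /= (reindex (@enum_val _ {: 'I_m2 * I})); last first.
  exact: onW_bij (enum_val_bij _).
by apply: eq_bigr => k _; rewrite scalerA.
Qed.

Section Maps.
Context (F G : normedModType K).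

(** If S is the image under a bounded linear map of a combination of values
   of T, and the same combination of the values of the forms of Phi gives forms
   of Psi, then domination passes from T to S: the combinations of values of S
   are combinations of values of T, with more terms. *)
Lemma dominated_transfer (I : finType) (w : I -> Y -> K) (h : I -> Y -> X)
    (v : F -> G) (T : X -> F) (S : Y -> G) (c d : R) :
  (0 < #|I|)%N -> 0 <= c -> 0 <= d ->
  linear v -> (forall z, rnorm (v z) <= d * rnorm z) ->
  (forall y, S y = v (\sum_t w t y *: T (h t y))) ->
  (forall phi, form_ball Phi phi ->
    fc_mem Psi (fun y => \sum_t w t y *: phi (h t y)) /\
    forall y, rnorm (\sum_t w t y *: phi (h t y)) <= c * fc_gauge Psi y) ->
  dominated Phi T ->
  dominated Psi S /\ dom_size Psi S <= d * dom_size Phi T * c.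
Proof.
move=> I0 c0 d0 lv vd SE phiPsi /dom_sizeP TC.
have C0 := dom_size_ge0 Phi T.
apply: dominated_le; first by rewrite !mulr_ge0.
move=> m1 m2 m10 m20 y l; rewrite -!mulrA.
have -> : S = v \o (fun y => \sum_t w t y *: T (h t y)) by apply/funext => z; rewrite SE.
apply: le_trans (comb_norm_comp _ _ _ d0 lv vd) _.
rewrite ler_wpM2l // comb_norm_expand.
have m0 : (0 < #|{: 'I_m2 * I}|)%N by rewrite card_prod card_ord muln_gt0 m20.
apply: le_trans (TC _ _ m10 m0 _ _) _; rewrite ler_wpM2l //.
apply: weak_norm_le => phi /phiPsi[mphi phic].
have [psi bpsi phiE] := form_normalize mphi c0 phic.
rewrite -(comb_norm_expand phi w h y l) phiE comb_normZ rnorm_of_real //.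
by rewrite ler_wpM2l // weak_norm_ub.
Qed.

(** The case of combinations of a single term. *)
Lemma dominated_pullback (w : Y -> K) (h : Y -> X)
    (v : F -> G) (T : X -> F) (S : Y -> G) (c d : R) :
  0 <= c -> 0 <= d ->
  linear v -> (forall z, rnorm (v z) <= d * rnorm z) ->
  (forall y, S y = w y *: v (T (h y))) ->
  (forall phi, fc_mem Phi phi -> fc_mem Psi (fun y => w y *: phi (h y))) ->
  (forall y, rnorm (w y : K^o) * fc_gauge Phi (h y) <= c * fc_gauge Psi y) ->
  dominated Phi T ->
  dominated Psi S /\ dom_size Psi S <= d * dom_size Phi T * c.
Proof.
move=> c0 d0 lv vd SE memPsi gaugeE.
apply: (@dominated_transfer 'I_1 (fun=> w) (fun=> h) v) => //.
- by rewrite card_ord.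
- by move=> y; rewrite big_ord1 SE linear_mapZ.
- move=> phi [mphi phiB].
  rewrite (_ : (fun y => _) = fun y => w y *: phi (h y)); last first.
    by apply/funext => y; rewrite big_ord1.
  split; first exact: memPsi.
  move=> y; rewrite big_ord1 rnormZ (le_trans _ (gaugeE y)) //.
  by rewrite ler_wpM2l ?rnorm_ge0.
Qed.

End Maps.

Section Maps.
Context (F : normedModType K).

Lemma dominated_weighted (w : Y -> K) (h : Y -> X) (T : X -> F) (c : R) :
  0 <= c ->
  (forall phi, fc_mem Phi phi -> fc_mem Psi (fun y => w y *: phi (h y))) ->
  (forall y, rnorm (w y : K^o) * fc_gauge Phi (h y) <= c * fc_gauge Psi y) ->
  dominated Phi T ->
  dominated Psi (fun y => w y *: T (h y)) /\
  dom_size Psi (fun y => w y *: T (h y)) <= c * dom_size Phi T.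
Proof.
move=> c0 memPsi gaugeE dT.
rewrite mulrC -[dom_size Phi T]mul1r.
apply: (@dominated_pullback F F w h id T) => //; first by move=> z; rewrite mul1r.
Qed.

Lemma dominated_subst (h : Y -> X) (T : X -> F) (c : R) : 0 <= c ->
  (forall phi, fc_mem Phi phi -> fc_mem Psi (phi \o h)) ->
  (forall y, fc_gauge Phi (h y) <= c * fc_gauge Psi y) ->
  dominated Phi T ->
  dominated Psi (T \o h) /\ dom_size Psi (T \o h) <= c * dom_size Phi T.
Proof.
move=> c0 memPsi gaugeE dT.
have -> : T \o h = fun y => (1 : K) *: T (h y).
  by apply/funext => y; rewrite scale1r.
apply: dominated_weighted => //.
  move=> phi /memPsi; congr (fc_mem Psi); apply/funext => y.
  by rewrite scale1r.
by move=> y; rewrite rnorm1 mul1r.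
Qed.

End Maps.

End Transfer.

End Domination.

#[global] Arguments form_class {R} s X.

(** * The ideals as classes of dominated maps *)

Section Ideals.
Context (R : realType) (s : scalar_kind) (p : R) (hp : 1 <= p).
Notation K := (scalars R s).
Notation banach := (completeNormedModType K).

Lemma gauge_multi_ge0 n (E : 'I_n -> banach) (x : forall i, E i) :
  0 <= \prod_(i < n) rnorm (x i).
Proof. by apply: prodr_ge0 => i _; exact: rnorm_ge0. Qed.

(** The continuous multilinear forms, gauged by the product of the norms. *)
Definition multi_forms n (E : 'I_n -> banach) : form_class s (forall i, E i) :=
  FormClass (@cont_multilinear0 _ _ n E K^o)
    (fun a phi psi => @cont_multilinearP _ _ n E K^o a phi psi)
    (@gauge_multi_ge0 n E).

Lemma gauge_poly_ge0 n (E : banach) (x : E) : 0 <= rnorm x ^+ n.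
Proof. by rewrite exprn_ge0 ?rnorm_ge0. Qed.

(** The continuous n-homogeneous scalar polynomials, gauged by the n-th power of
   the norm. *)
Definition poly_forms n (E : banach) : form_class s E :=
  FormClass (@cont_poly0 _ _ n E K^o)
    (fun a phi psi => @cont_polyP _ _ n E K^o a phi psi)
    (@gauge_poly_ge0 n E).

Lemma multi_form_ballE n (E : 'I_n -> banach) :
  [set phi : (forall k, E k) -> K^o | cont_multilinear phi /\ ml_norm phi <= 1] =
  form_ball (multi_forms E).
Proof.
apply/seteqP; split=> phi [cphi phi1]; split=> //.
  move=> x; rewrite (le_trans (ml_norm_bound cphi x)) //=.
  by rewrite ler_piMl ?gauge_multi_ge0.
by apply: ml_norm_le => // x; rewrite mul1r; exact: phi1.
Qed.

Lemma poly_form_ballE n (E : banach) :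
  [set q : E -> K^o | cont_poly n q /\ map_norm q <= 1] = form_ball (poly_forms n E).
Proof.
apply/seteqP; split=> q [cq q1]; split=> //.
  move=> x; rewrite (le_trans (map_norm_bound x cq)) //=.
  by rewrite ler_piMl ?gauge_poly_ge0.
by apply: (map_norm_le (n := n)) => // x; rewrite mul1r; exact: q1.
Qed.

Lemma FSt_multi_boundE n (E : 'I_n -> banach) (F : banach) (T : (forall i, E i) -> F) :
  FSt_multi_bound p T = dom_bound p (multi_forms E) T.
Proof. by rewrite /FSt_multi_bound multi_form_ballE. Qed.

Lemma FSt_poly_boundE n (E F : banach) (P : E -> F) :
  FSt_poly_bound p n P = dom_bound p (poly_forms n E) P.
Proof. by rewrite /FSt_poly_bound poly_form_ballE. Qed.

Lemma FSt_multi_mem n (E : 'I_n -> banach) (F : banach) :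
  ml_mem (FSt_multi s p n) (E := E) (F := F) =
  [set T | cont_multilinear T /\ dominated p (multi_forms E) T].
Proof. by apply/funext => T; rewrite /= /dominated FSt_multi_boundE. Qed.

Lemma FSt_multi_size n (E : 'I_n -> banach) (F : banach) :
  ml_size (FSt_multi s p n) (E := E) (F := F) = @dom_size _ _ p _ (multi_forms E) F.
Proof. by apply/funext => T; rewrite /= /dom_size FSt_multi_boundE. Qed.

Lemma FSt_poly_mem n (E F : banach) :
  map_mem (FSt_poly s p n) (E := E) (F := F) =
  [set P | cont_poly n P /\ dominated p (poly_forms n E) P].
Proof. by apply/funext => P; rewrite /= /dominated FSt_poly_boundE. Qed.

Lemma FSt_poly_size n (E F : banach) :
  map_size (FSt_poly s p n) (E := E) (F := F) = @dom_size _ _ p _ (poly_forms n E) F.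
Proof. by apply/funext => P; rewrite /= /dom_size FSt_poly_boundE. Qed.

(** For a linear map, a linear combination of values is a value: the bounds
   with and without linear combinations agree. *)
Lemma summing_boundE (E F : banach) (u : E -> F) : cont_linear u ->
  summing_bound p u = dom_bound p (poly_forms 1 E) u.
Proof.
move=> [lu _].
have ballE : [set phi : E -> K^o | cont_linear phi /\ map_norm phi <= 1] =
    form_ball (poly_forms 1 E).
  rewrite -poly_form_ballE; apply/seteqP; split=> phi [cphi ?]; split=> //.
    exact/cont_poly1P.
  exact/cont_poly1P.
have combE (V : normedModType K) (v : E -> V) m1 m2 (x : 'I_m1 -> 'I_m2 -> E)
    (l : 'I_m1 -> 'I_m2 -> K) : linear v ->
    comb_norm p v x l = lp_norm p (fun j => rnorm (v (\sum_i l j i *: x j i))).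
  move=> lv; congr lp_norm; apply/funext => j; rewrite (linear_map_sum _ _ lv).
  by under [in RHS]eq_bigr do rewrite (linear_mapZ _ _ lv).
have weakE m1 m2 (x : 'I_m1 -> 'I_m2 -> E) (l : 'I_m1 -> 'I_m2 -> K) :
    weak_norm p (poly_forms 1 E) x l =
    sup [set lp_norm p (fun j => rnorm (phi (\sum_i l j i *: x j i))) |
      phi in form_ball (poly_forms 1 E)].
  apply: (congr1 sup).
  apply/seteqP; split=> _ [phi bphi <-]; exists phi; first exact: bphi.
    by have [/cont_poly1P[lphi _] _] := bphi; rewrite combE.
  exact: bphi.
  by have [/cont_poly1P[lphi _] _] := bphi; rewrite combE.
apply/funext => C; rewrite /summing_bound ballE; apply/propext; split.
  move=> uC m1 m2 _ _ x l; rewrite (combE _ _ _ _ _ _ lu) weakE.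
  exact: (uC m1 (fun j => \sum_i l j i *: x j i)).
(* both sides vanish for the empty family *)
move=> uC [|N] x; last first.
  have := uC N.+1 1%N isT isT (fun j _ => x j) (fun _ _ => 1).
  rewrite (combE _ _ _ _ _ _ lu) weakE.
  have oneE (V : normedModType K) (v : E -> V) :
      lp_norm p (fun j => rnorm (v (\sum_(i < 1) (1 : K) *: x j))) =
      lp_norm p (fun j => rnorm (v (x j))).
    by congr lp_norm; apply/funext => j; rewrite big_ord1 scale1r.
  rewrite oneE => /le_trans; apply; rewrite le_eqVlt; apply/orP; left; apply/eqP.
  apply: (congr1 (fun A => C * sup A)); apply/seteqP.
  by split=> _ [phi bphi <-]; exists phi; [exact: bphi|rewrite oneE
    |exact: bphi|rewrite oneE].
rewrite (lp_norm_empty hp) (_ : [set _ | phi in _] = [set 0]).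
  by rewrite sup1 mulr0.
apply/seteqP; split=> [_ [phi _ <-]|_ ->]; first by rewrite (lp_norm_empty hp).
by exists 0; [exact: form_ball0|rewrite (lp_norm_empty hp)].
Qed.

Lemma summing_mem (E F : banach) : map_mem (summing s p) (E := E) (F := F) =
  map_mem (FSt_poly s p 1) (E := E) (F := F).
Proof.
rewrite FSt_poly_mem; apply/seteqP; split=> u /=.
  by move=> [cu]; rewrite (summing_boundE cu) => du; split=> //; exact/cont_poly1P.
move=> [/cont_poly1P cu du]; split=> //.
by rewrite summing_boundE.
Qed.

Lemma summing_size (E F : banach) (u : E -> F) : cont_linear u ->
  map_size (summing s p) u = map_size (FSt_poly s p 1) u.
Proof.
by move=> cu; rewrite FSt_poly_size /dom_size -(summing_boundE cu).
Qed.

Lemma summing_memP (E F : banach) (u : E -> F) : map_mem (summing s p) u ->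
  [/\ cont_linear u, dominated p (poly_forms 1 E) u &
      map_size (summing s p) u = dom_size p (poly_forms 1 E) u].
Proof.
move=> mu; have [cu _] := mu; rewrite (summing_size cu) FSt_poly_size.
by move: mu; rewrite summing_mem FSt_poly_mem => -[].
Qed.

Lemma summing_intro (E F : banach) (u : E -> F) C : cont_linear u ->
  dominated p (poly_forms 1 E) u /\ dom_size p (poly_forms 1 E) u <= C ->
  map_mem (summing s p) u /\ map_size (summing s p) u <= C.
Proof.
move=> cu [du uC]; rewrite (summing_size cu) FSt_poly_size summing_mem FSt_poly_mem.
by split=> //; split=> //; exact/cont_poly1P.
Qed.

Lemma FSt_multi_intro n (E : 'I_n -> banach) (F : banach) (T : (forall i, E i) -> F) C :
  cont_multilinear T ->
  dominated p (multi_forms E) T /\ dom_size p (multi_forms E) T <= C ->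
  ml_mem (FSt_multi s p n) T /\ ml_size (FSt_multi s p n) T <= C.
Proof. by move=> cT [dT TC]; rewrite FSt_multi_mem FSt_multi_size. Qed.

Lemma FSt_poly_intro n (E F : banach) (P : E -> F) C : cont_poly n P ->
  dominated p (poly_forms n E) P /\ dom_size p (poly_forms n E) P <= C ->
  map_mem (FSt_poly s p n) P /\ map_size (FSt_poly s p n) P <= C.
Proof. by move=> cP [dP PC]; rewrite FSt_poly_mem FSt_poly_size. Qed.

Lemma linear_id_map (V : normedModType K) : linear (@id V).
Proof. by []. Qed.

Lemma rnorm_id_le (V : normedModType K) (z : V) : rnorm (id z) <= 1 * rnorm z.
Proof. by rewrite mul1r. Qed.

Lemma cont_linear_bound (E : banach) (F : normedModType K) (u : E -> F) x :
  cont_linear u -> rnorm (u x) <= map_norm u * rnorm x.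
Proof. by move=> /cont_poly1P cu; rewrite -[rnorm x]expr1; exact: map_norm_bound. Qed.

Lemma cont_linear_norm_ge0 (E : banach) (F : normedModType K) (u : E -> F) :
  cont_linear u -> 0 <= map_norm u.
Proof. by move=> /cont_poly1P cu; exact: map_norm_ge0 cu. Qed.

End Ideals.

(** * The conditions of coherence and compatibility *)

Section Conditions.
Context (R : realType) (s : scalar_kind) (p : R) (hp : 1 <= p).
Notation K := (scalars R s).
Notation banach := (completeNormedModType K).

Lemma dominated_diag n (E F : banach) (A : ('I_n -> E) -> F) :
  dominated p (multi_forms (fun _ : 'I_n => E)) A ->
  dominated p (poly_forms n E) (fun x => A (fun=> x)).
Proof.
move=> dA.
apply: (dominated_subst hp (Psi := poly_forms n E) (h := fun x (_ : 'I_n) => x) ler01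
  _ _ dA).1.
  by move=> phi; exact: cont_multilinear_diag.
by move=> x; rewrite mul1r /= prodr_const card_ord.
Qed.

(** By polarization, the combinations of values of the polar form of P are
   combinations of values of P, with 2 ^ n times as many terms. *)
Lemma dominated_polar n (E F : banach) (P : E -> F) : cont_poly n P ->
  dominated p (poly_forms n E) P ->
  dominated p (multi_forms (fun _ : 'I_n => E)) (polar n P).
Proof.
move=> cP dP.
pose c : R := rnorm ((n`!)%:R^-1 : K^o) * (2 ^ n)%:R * n%:R ^+ n.
have c0 : 0 <= c by rewrite !mulr_ge0 ?exprn_ge0 ?rnorm_ge0.
apply: (dominated_transfer hp (Psi := multi_forms (fun _ : 'I_n => E))
  (w := fun b _ => (n`!)%:R^-1 * cube_sign s b) (h := fun b x => cube_point b x)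
  _ c0 ler01 (@linear_id_map _ _ F) (@rnorm_id_le _ _ F) _ _ dP).1.
- by rewrite card_ffun card_bool expn_gt0.
- by move=> x; exact: polar_formula.
- move=> q; rewrite -poly_form_ballE => -[cq q1].
  have qE : (fun x => \sum_b ((n`!)%:R^-1 * cube_sign s b) *: q (cube_point b x)) =
      polar n q.
    by apply/funext => x; rewrite polar_formula.
  rewrite qE; split; first by case: (polarP cq).
  by move=> x; rewrite -polar_formula //; exact: polar_norm_le.
Qed.

Lemma FSt_CH5 : CH5 (@FSt_poly R s p) (@FSt_multi R s p).
Proof.
move=> n _ E F P cP; have [cA _ AP] := polarP cP.
rewrite FSt_multi_mem FSt_poly_mem; split=> -[_ dom].
  by split=> //; exact: dominated_polar.
split=> //; rewrite (_ : P = fun x => polar n P (fun=> x)).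
  exact: dominated_diag.
by apply/funext => x; rewrite AP.
Qed.

Lemma FSt_CP5 : CP5 (@FSt_poly R s p) (@FSt_multi R s p).
Proof. by move=> n n2; apply: FSt_CH5; exact: ltnW. Qed.

Lemma prod_insert_at k (E : 'I_k.+1 -> banach) j (a : E j)
    (x : forall i : 'I_k, E (lift j i)) :
  \prod_(i < k.+1) rnorm (insert_at (E := fun l => E l) a x i : E i) =
  rnorm a * \prod_(i < k) rnorm (x i).
Proof.
rewrite (bigD1_ord j) //= insert_at_same; congr (_ * _).
by apply: eq_bigr => i _; rewrite insert_at_lift.
Qed.

Lemma FSt_CH1 : CH1 (@FSt_multi R s p) 1.
Proof.
move=> k _ E F T j a; rewrite FSt_multi_mem => -[cT dT] Ta; rewrite mul1r.
apply: FSt_multi_intro; first exact: cont_multilinear_insert.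
rewrite FSt_multi_size mulrC.
apply: (dominated_subst hp (Psi := multi_forms (fun i => E (lift j i)))
  (h := fun x => insert_at a x) (rnorm_ge0 a) _ _ dT).
  by move=> phi; exact: cont_multilinear_insert.
by move=> x /=; rewrite prod_insert_at.
Qed.

Lemma FSt_CH2 : CH2 (@FSt_poly R s p) (@FSt_multi R s p) 1.
Proof.
move=> k _ E F P a; rewrite FSt_poly_mem => -[cP dP] Pa; rewrite mul1r.
have [cA _ _] := polarP cP; have dA := dominated_polar cP dP.
pose h (x : E) (i : 'I_k.+1) := if i == ord0 then a else x.
have hE x : h x = insert_at (E := fun=> E) (j := ord0) a (fun _ : 'I_k => x).
  apply/funext => i; rewrite /h; case: (unliftP ord0 i) => [i' ->|->].
    by rewrite (insert_at_lift (E := fun=> E)).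
  by rewrite (insert_at_same (E := fun=> E)).
have poly_h (V : normedModType K) (A : ('I_k.+1 -> E) -> V) :
    cont_multilinear (E := fun=> E) A -> cont_poly k (A \o h).
  move=> cA'; rewrite (_ : A \o h =
      fun x => A (insert_at (E := fun=> E) (j := ord0) a (fun=> x))).
    exact: (cont_multilinear_diag
      (cont_multilinear_insert (E := fun=> E) (j := ord0) a cA')).
  by apply/funext => x /=; rewrite hE.
have [dPa sizePa] : dominated p (poly_forms k E) (polar k.+1 P \o h) /\
    dom_size p (poly_forms k E) (polar k.+1 P \o h) <=
    rnorm a * dom_size p (multi_forms (fun _ : 'I_k.+1 => E)) (polar k.+1 P).
  apply: (dominated_subst hp (rnorm_ge0 a) _ _ dA) => [phi mphi|x].
    exact: poly_h.
  by rewrite /= big_ord_recl /h /= prodr_const card_ord.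
apply: FSt_poly_intro; first exact: poly_h.
split=> //; apply: le_trans sizePa _; rewrite mulrC ler_wpM2r ?rnorm_ge0 //.
by rewrite FSt_multi_size le_max lexx.
Qed.

Lemma prod_lift_max k (f : 'I_k.+1 -> R) :
  \prod_(i < k.+1) f i = (\prod_(i < k) f (lift ord_max i)) * f ord_max.
Proof.
rewrite big_ord_recr /=; congr (_ * _); apply: eq_bigr => i _; congr f.
by apply: val_inj; rewrite /= /bump leqNgt ltn_ord.
Qed.

Lemma FSt_CH3 : CH3 (@FSt_multi R s p) 1.
Proof.
move=> k _ E F T g; rewrite FSt_multi_mem => -[cT dT] cg gT; rewrite mul1r.
have g0 := cont_linear_norm_ge0 cg.
apply: FSt_multi_intro; first exact: cont_multilinear_lift_mulr.
rewrite FSt_multi_size.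
apply: (dominated_weighted hp (Psi := multi_forms E) (w := fun x => g (x ord_max))
  (h := fun x i => x (lift ord_max i)) g0 _ _ dT).
  by move=> phi mphi; exact: cont_multilinear_lift_mulr.
move=> x /=; rewrite prod_lift_max mulrCA mulrC ler_wpM2l ?gauge_multi_ge0 //.
exact: cont_linear_bound.
Qed.

Lemma FSt_CH4 : CH4 (@FSt_poly R s p) 1.
Proof.
move=> k _ E F P g; rewrite FSt_poly_mem => -[cP dP] cg gP; rewrite mul1r.
have g0 := cont_linear_norm_ge0 cg.
apply: FSt_poly_intro; first exact: cont_poly_mul.
rewrite FSt_poly_size.
apply: (dominated_weighted hp (Psi := poly_forms k.+1 E) (w := g)
  (h := id) g0 _ _ dP).
  by move=> phi mphi; exact: cont_poly_mul.
move=> x /=; rewrite exprS mulrA ler_wpM2r ?exprn_ge0 ?rnorm_ge0 //.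
exact: cont_linear_bound.
Qed.

Lemma FSt_CP1 : CP1 (summing s p) (@FSt_multi R s p) 1.
Proof.
move=> n _ E F T k a; rewrite FSt_multi_mem => -[cT dT] Tk; rewrite mul1r.
apply: summing_intro => //; first exact: cont_linear_coord.
rewrite FSt_multi_size mulrC.
apply: (dominated_subst hp (Psi := poly_forms 1 (E k)) (h := fun x => dfwith a k x)
  _ _ _ dT).
- by apply: prodr_ge0 => j _; exact: rnorm_ge0.
- by move=> phi mphi; apply/cont_poly1P; exact: cont_linear_coord.
- move=> x /=; rewrite (bigD1 k) //= dfwithin mulrC expr1 ler_wpM2r ?rnorm_ge0 //.
  by rewrite le_eqVlt; apply/orP; left; apply/eqP; apply: eq_bigr => j jk;
     rewrite dfwithout // eq_sym.
Qed.

Lemma FSt_CP2 : CP2 (summing s p) (@FSt_poly R s p) (@FSt_multi R s p) 1.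
Proof.
move=> n _ E F P a; rewrite FSt_poly_mem => -[cP dP] Pa; rewrite mul1r.
have [cA _ _] := polarP cP; have dA := dominated_polar cP dP.
pose h (x : E) (i : 'I_n.+1) := if i == ord_max then x else a.
have hE x : h x = dfwith (T := fun=> E) (fun=> a) ord_max x.
  apply/funext => i; rewrite /h.
  by case: (dfwithP (T := fun=> E)) => [|{}i]; rewrite ?eqxx // eq_sym => /negbTE ->.
have linear_h (V : normedModType K) (A : ('I_n.+1 -> E) -> V) :
    cont_multilinear (E := fun=> E) A -> cont_linear (A \o h).
  move=> cA'; rewrite (_ : A \o h =
      fun x => A (dfwith (T := fun=> E) (fun=> a) ord_max x)).
    exact: (cont_linear_coord (E := fun=> E) ord_max (fun=> a) cA').
  by apply/funext => x /=; rewrite hE.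
have an0 : 0 <= rnorm a ^+ n by rewrite exprn_ge0 ?rnorm_ge0.
have [dPa sizePa] : dominated p (poly_forms 1 E) (polar n.+1 P \o h) /\
    dom_size p (poly_forms 1 E) (polar n.+1 P \o h) <=
    rnorm a ^+ n * dom_size p (multi_forms (fun _ : 'I_n.+1 => E)) (polar n.+1 P).
  apply: (dominated_subst hp an0 _ _ dA) => [phi mphi|x].
    by apply/cont_poly1P; exact: linear_h.
  rewrite /= prod_lift_max /h eqxx expr1.
  under eq_bigr do rewrite eq_sym (negbTE (neq_lift _ _)).
  by rewrite prodr_const card_ord.
apply: summing_intro => //; first exact: linear_h.
split=> //; apply: le_trans sizePa _; rewrite mulrC ler_wpM2r //.
by rewrite FSt_multi_size le_max lexx.
Qed.

Lemma FSt_CP3 : CP3 (summing s p) (@FSt_multi R s p) 1.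
Proof.
move=> n _ E F u g /(summing_memP hp)[cu du ->] cg gu; rewrite mul1r.
have cw := cont_multilinear_prod (E := fun i => E (lift ord_max i)) cg.
apply: FSt_multi_intro; first exact: (cont_multilinear_lift_mull cw cu).
apply: (dominated_weighted hp (Psi := multi_forms E)
  (w := fun x => \prod_(i < n) g i (x (lift ord_max i)))
  (h := fun x => x ord_max) _ _ _ du).
- by apply: prodr_ge0 => i _; exact: cont_linear_norm_ge0.
- by move=> phi /cont_poly1P cphi; exact: (cont_multilinear_lift_mull cw cphi).
- move=> x /=; rewrite prod_lift_max expr1 mulrA ler_wpM2r ?rnorm_ge0 //.
  rewrite rnorm_prod -big_split /=; apply: ler_prod => i _.
  by rewrite rnorm_ge0 cont_linear_bound.
Qed.

Lemma cont_poly_pow_mul n (E : banach) (F : normedModType K) (u : E -> F)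
    (g : E -> K^o) :
  cont_linear u -> cont_linear g -> cont_poly n.+1 (fun x => g x ^+ n *: u x).
Proof.
move=> cu cg; elim: n => [|n IH].
  rewrite (_ : (fun x => _) = u); first exact/cont_poly1P.
  by apply/funext => x; rewrite scale1r.
have := cont_poly_mul cg IH.
by congr cont_poly; apply/funext => x; rewrite scalerA exprS.
Qed.

Lemma FSt_CP4 : CP4 (summing s p) (@FSt_poly R s p) 1.
Proof.
move=> n _ E F u g /(summing_memP hp)[cu du ->] cg gu; rewrite mul1r.
have g0 := cont_linear_norm_ge0 cg.
apply: FSt_poly_intro; first exact: cont_poly_pow_mul.
apply: (dominated_weighted hp (Psi := poly_forms n.+1 E)
  (w := fun x => g x ^+ n) (h := id) _ _ _ du).
- by rewrite exprn_ge0.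
- by move=> phi /cont_poly1P cphi; exact: cont_poly_pow_mul.
- move=> x /=; rewrite rnormX expr1 exprSr mulrA ler_wpM2r ?rnorm_ge0 //.
  rewrite -exprMn lerXn2r ?nnegrE ?rnorm_ge0 ?mulr_ge0 ?rnorm_ge0 //.
  exact: cont_linear_bound.
Qed.

End Conditions.

(** * The sequence of ideals *)

Section IdealSequence.
Context (R : realType) (s : scalar_kind) (p : R) (hp : 1 <= p).
Notation K := (scalars R s).
Notation banach := (completeNormedModType K).

Lemma FSt_poly_ideal n : (1 <= n)%N -> normed_poly_ideal n (FSt_poly s p n).
Proof.
move=> n1; split.
- by move=> E F P; rewrite FSt_poly_mem => -[].
- move=> E F; rewrite FSt_poly_mem FSt_poly_size.
  apply: (dom_normed_subspace hp (poly_forms n E)); first exact: cont_poly0.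
  by move=> a P Q; exact: cont_polyP.
- move=> E F g b cg; rewrite FSt_poly_mem; split; first exact: cont_poly_pow.
  have g0 : 0 <= map_norm g ^+ n by rewrite exprn_ge0 ?cont_linear_norm_ge0.
  exists (rnorm b * map_norm g ^+ n); first by rewrite mulr_ge0 ?rnorm_ge0.
  apply: (dominated_rank1 hp (Phi := poly_forms n E) (phi := fun x => g x ^+ n)) => //.
    have := cont_poly_pow n (F := scalar_banach R s) (1 : K) cg.
    by congr cont_poly; apply/funext => x; exact: mulr1.
  move=> x /=; rewrite rnormX -exprMn.
  by rewrite lerXn2r ?nnegrE ?mulr_ge0 ?rnorm_ge0 ?cont_linear_norm_ge0 //
    cont_linear_bound.
- move=> E F G H u P v cu; rewrite FSt_poly_mem => -[cP dP] cv.
  apply: FSt_poly_intro; first exact: cont_poly_comp.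
  rewrite FSt_poly_size.
  apply: (dominated_pullback hp (Psi := poly_forms n G) (w := fun=> 1) (h := u)
    (v := v) _ _ _ _ _ _ _ dP).
  + by rewrite exprn_ge0 // cont_linear_norm_ge0.
  + exact: cont_linear_norm_ge0.
  + by case: cv.
  + by move=> z; exact: cont_linear_bound.
  + by move=> y; rewrite scale1r.
  + move=> phi mphi.
    have := cont_poly_comp (H := scalar_banach R s) (v := id) cu mphi
      (conj (@linear_id_map _ _ _) (fun x => cvg_id)).
    by congr cont_poly; apply/funext => y /=; rewrite scale1r.
  + move=> y; rewrite rnorm1 mul1r /= -exprMn.
    by rewrite lerXn2r ?nnegrE ?mulr_ge0 ?rnorm_ge0 ?cont_linear_norm_ge0 //
      cont_linear_bound.
- rewrite FSt_poly_size.
  have cX : cont_poly n (fun x : scalar_banach R s => (x : K^o) ^+ n : K^o).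
    have := cont_poly_pow n (E := scalar_banach R s)
      (F := scalar_banach R s) (g := id) (1 : K)
      (conj (@linear_id_map _ _ _) (fun x => cvg_id)).
    by congr cont_poly; apply/funext => x; exact: mulr1.
  apply: (dom_size_unit hp (Phi := poly_forms n (scalar_banach R s))
    (x := (1 : K) : scalar_banach R s) cX).
  + by move=> x; rewrite rnormX.
  + by rewrite expr1n rnorm1.
  + by rewrite /= rnorm1 expr1n.
Qed.

Lemma FSt_multi_ideal n : (1 <= n)%N -> normed_multi_ideal (FSt_multi s p n).
Proof.
move=> n1; split.
- by move=> E F T; rewrite FSt_multi_mem => -[].
- move=> E F; rewrite FSt_multi_mem FSt_multi_size.
  apply: (dom_normed_subspace hp (multi_forms E)); first exact: cont_multilinear0.
  by move=> a T U; exact: cont_multilinearP.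
- move=> E F g b cg; rewrite FSt_multi_mem.
  have cG := cont_multilinear_prod cg.
  split; first exact: cont_multilinear_scale.
  have g0 : 0 <= \prod_(i < n) map_norm (g i).
    by apply: prodr_ge0 => i _; exact: cont_linear_norm_ge0.
  exists (rnorm b * \prod_(i < n) map_norm (g i)).
    by rewrite mulr_ge0 ?rnorm_ge0.
  apply: (dominated_rank1 hp (Phi := multi_forms E) b cG) => // x /=.
  rewrite rnorm_prod -big_split /=; apply: ler_prod => i _.
  by rewrite rnorm_ge0 cont_linear_bound.
- move=> E G F H u T v cu; rewrite FSt_multi_mem => -[cT dT] cv vTu.
  apply: FSt_multi_intro; first exact: (cont_multilinear_comp cu cT cv).
  rewrite FSt_multi_size.
  apply: (dominated_pullback hp (Psi := multi_forms G) (w := fun=> 1)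
    (h := fun x i => u i (x i)) (v := v) _ _ _ _ _ _ _ dT).
  + by apply: prodr_ge0 => i _; exact: cont_linear_norm_ge0.
  + exact: cont_linear_norm_ge0.
  + by case: cv.
  + by move=> z; exact: cont_linear_bound.
  + by move=> y; rewrite scale1r.
  + move=> phi mphi.
    have := cont_multilinear_comp (v := id) cu mphi
      (conj (@linear_id_map _ _ _) (fun x => cvg_id)).
    by congr cont_multilinear; apply/funext => y /=; rewrite scale1r.
  + move=> y; rewrite rnorm1 mul1r /= -big_split /=; apply: ler_prod => i _.
    by rewrite rnorm_ge0 cont_linear_bound.
- rewrite FSt_multi_size.
  have cX : cont_multilinear (E := fun _ : 'I_n => scalar_banach R s)
      (fun x => \prod_(i < n) (x i : K^o) : K^o).
    apply: (cont_multilinear_prod (E := fun _ : 'I_n => scalar_banach R s)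
      (g := fun=> id)).
    by move=> _; split; [exact: linear_id_map|move=> x; exact: cvg_id].
  apply: (dom_size_unit hp (Phi := multi_forms (fun _ : 'I_n => scalar_banach R s))
    (x := fun=> (1 : K) : scalar_banach R s) cX).
  + by move=> x; rewrite rnorm_prod.
  + by rewrite big1 // rnorm1.
  + by rewrite /= big1 // => i _; rewrite rnorm1.
Qed.

Lemma normed_subspace_eq (V : lmodType K) (D : set V) (N N' : V -> R) :
  (forall u, D u -> N u = N' u) -> normed_subspace D N' -> normed_subspace D N.
Proof.
move=> NE [D0 DP N0 Neq0 NZ ND].
have DZ a u : D u -> D (a *: u) by move=> Du; rewrite -[a *: u]addr0; exact: DP.
have DD u v : D u -> D v -> D (u + v).
  by move=> Du Dv; rewrite -[u]scale1r; exact: DP.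
split=> [|a u v|u Du|u Du|a u Du|u v Du Dv].
- exact: D0.
- exact: DP.
- by rewrite NE //; exact: N0.
- by rewrite NE //; exact: Neq0.
- by rewrite (NE _ (DZ a _ Du)) (NE _ Du); exact: NZ.
- by rewrite (NE _ (DD _ _ Du Dv)) (NE _ Du) (NE _ Dv); exact: ND.
Qed.

(** The members of the ideal of p-summing operators and their norms are those of
   the ideal of factorable strongly p-summing 1-homogeneous polynomials. *)
Lemma summing_ideal : normed_operator_ideal (summing s p).
Proof.
have [sub nrm fin cmp one] := FSt_poly_ideal (leqnn 1).
have sizeE (E F : banach) (u : E -> F) : map_mem (FSt_poly s p 1) u ->
    map_size (summing s p) u = map_size (FSt_poly s p 1) u.
  by rewrite -(summing_mem hp) => -[cu _]; exact: (summing_size hp cu).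
split.
- by move=> E F u [].
- move=> E F; rewrite (summing_mem hp).
  by apply: (normed_subspace_eq _ (nrm E F)) => u; exact: sizeE.
- by move=> E F g b cg; rewrite (summing_mem hp); exact: fin.
- move=> E F G H u P v cu; rewrite !(summing_mem hp) => mP cv.
  have [mvPu sizevPu] := cmp _ _ _ _ u P v cu mP cv.
  by rewrite (sizeE _ _ _ mvPu) (sizeE _ _ _ mP).
- rewrite sizeE; first exact: one.
  have := fin (scalar_banach R s) (scalar_banach R s) id (1 : K)
    (conj (@linear_id_map _ _ _) (fun x => cvg_id)).
  rewrite (_ : (fun x => _) = fun x => (x : K^o) ^+ 1) //.
  by apply/funext => x; exact: mulr1.
Qed.

Lemma cont_multilinear1P (E : 'I_1 -> banach) (F : normedModType K) (u : E ord0 -> F) :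
  cont_multilinear (fun x : forall i, E i => u (x ord0)) <-> cont_linear u.
Proof.
split=> [cu|[lu cu]].
  have := cont_linear_coord ord0 (fun=> 0) cu.
  by congr cont_linear; apply/funext => y; rewrite dfwithin.
split.
  by move=> x i a; rewrite (ord1 i) => y z; rewrite !dfwithin lu.
move=> x; apply: (@continuous_comp (prod_topology E) _ _ (fun x => x ord0) u).
  exact: continuous_coord.
exact: cu.
Qed.

(** The domination passes from u to u1 and back, by composition with the
   projection onto the only variable and with its inverse. *)
Lemma FSt_multi1 (E : 'I_1 -> banach) (F : banach) (u : E ord0 -> F) :
  let u1 := fun x : forall i, E i => u (x ord0) in
  (ml_mem (FSt_multi s p 1) u1 <-> map_mem (summing s p) u) /\
  (map_mem (summing s p) u ->
   ml_size (FSt_multi s p 1) u1 = map_size (summing s p) u).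
Proof.
move=> u1.
have up : dominated p (poly_forms 1 (E ord0)) u ->
    dominated p (multi_forms E) u1 /\
    dom_size p (multi_forms E) u1 <= 1 * dom_size p (poly_forms 1 (E ord0)) u.
  apply: (dominated_subst hp (h := fun x : forall i, E i => x ord0) ler01).
    by move=> phi /cont_poly1P cphi; apply/cont_multilinear1P.
  by move=> x; rewrite /= mul1r big_ord1 expr1.
have down : dominated p (multi_forms E) u1 ->
    dominated p (poly_forms 1 (E ord0)) u /\
    dom_size p (poly_forms 1 (E ord0)) u <= 1 * dom_size p (multi_forms E) u1.
  have -> : u = u1 \o (fun y => dfwith (fun=> 0) ord0 y).
    by apply/funext => y; rewrite /u1 /= dfwithin.
  apply: (dominated_subst hp ler01).
    by move=> phi mphi; apply/cont_poly1P; exact: cont_linear_coord.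
  by move=> y; rewrite /= mul1r big_ord1 dfwithin expr1.
split.
  split.
    rewrite FSt_multi_mem => -[/cont_multilinear1P cu1 /down[du _]].
    by apply: (summing_intro hp cu1 (conj du (lexx _))).1.
  move=> /(summing_memP hp)[cu /up[du1 _] _]; rewrite FSt_multi_mem.
  by split=> //; apply/cont_multilinear1P.
move=> /(summing_memP hp)[cu du ->]; rewrite FSt_multi_size.
have [du1 le1] := up du; have [_ le2] := down du1.
by apply/le_anti; rewrite -{1}[dom_size p (poly_forms _ _) _]mul1r le1 -[leRHS]mul1r le2.
Qed.

Lemma FSt_ideal_sequence :
  ideal_sequence (summing s p) (@FSt_poly R s p) (@FSt_multi R s p).
Proof.
split.
- exact: summing_ideal.
- exact: FSt_poly_ideal.
- exact: FSt_multi_ideal.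
- move=> E F u; rewrite (summing_mem hp); split=> // mu; apply/esym/summing_size => //.
  by move: mu; rewrite -(summing_mem hp) => -[].
- exact: FSt_multi1.
Qed.

End IdealSequence.

Theorem theorem6p1 (R : realType) (s : scalar_kind) (p : R) (hp : 1 <= p) :
  coherent (summing s p) (@FSt_poly R s p) (@FSt_multi R s p) /\
  compatible (summing s p) (@FSt_poly R s p) (@FSt_multi R s p).
Proof.
split; (split; first exact: FSt_ideal_sequence);
  exists 1, 1, 1, 1; (split; first by split; exact: ltr01); split.
- exact: FSt_CH1.
- exact: FSt_CH2.
- exact: FSt_CH3.
- exact: FSt_CH4.
- exact: FSt_CH5.
- exact: FSt_CP1.
- exact: FSt_CP2.
- exact: FSt_CP3.
- exact: FSt_CP4.
- exact: FSt_CP5.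
Qed.
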